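(* Let $m_1,m_2,m_3$ be positive integers and let $G=Q^{\mathrm{M\ddot{o}b}}_{2m_1,2m_2,2m_3}$ be the three-dimensional Möbius grid graph with the boustrophedon labelling and the orientation $\mathcal{O}$ described below. Give every vertex weight $x$, and give weight $a_1$, $a_2$, $a_3$ to the edges along the first, second, third coordinate direction respectively (the dashed edges counting as edges along the first direction). Then the partition function of the monopole-dimer (loop-vertex) model on $(G,\mathcal{O})$ is $$\prod_{i_1=1}^{m_1}\prod_{i_2=1}^{m_2}\prod_{i_3=1}^{m_3}\Big(x^2+4a_1^2\sin^2\frac{(4i_1-1)\pi}{4m_1}+4a_2^2\cos^2\frac{i_2\pi}{2m_2+1}+4a_3^2\cos^2\frac{i_3\pi}{2m_3+1}\Big)^{4}.$$
   Context: $Q_{n_1,n_2,n_3}=P_{n_1}\square P_{n_2}\square P_{n_3}$ is the grid graph on vertex set $[n_1]\times[n_2]\times[n_3]$, two vertices adjacent iff they differ by $1$ in exactly one coordinate (an edge ''along'' that coordinate direction). The Möbius grid graph $Q^{\mathrm{M\ddot{o}b}}_{n_1,n_2,n_3}$ is obtained from $Q_{n_1,n_2,n_3}$ by adding, for all $k_2\in[n_2],k_3\in[n_3]$, an edge (''dashed edge'') between $(1,k_2,k_3)$ and $(n_1,n_2-k_2+1,n_3-k_3+1)$; the edges of $Q_{n_1,n_2,n_3}$ are ''solid edges''. Boustrophedon labelling of $[2n_1]\times[2n_2]\times[2n_3]$: vertex $(p,q,r)$ gets label $8tn_1n_2+4sn_1+p$ if $q=2s+1,r=2t+1$; $8tn_1n_2+4sn_1-p+1$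 if $q=2s,r=2t+1$; $8tn_1n_2-4sn_1-p+1$ if $q=2s+1,r=2t$; $8tn_1n_2-4sn_1+p$ if $q=2s,r=2t$. Orientation $\mathcal{O}$: every solid edge is directed from its lower-labelled to its higher-labelled endpoint; the dashed edge at the vertex labelled $1$ is directed away from that vertex; the remaining dashed edges are directed so that every two-dimensional square (4-cycle formed by two dashed edges and the solid edges joining their endpoints) satisfies the clockwise-odd property, i.e. has an odd number of edges directed along each of its two traversal directions. Loop-vertex (monopole-dimer) model on $(G,\mathcal{O})$ with vertex weights $x(v)$ and edge weights $a_{v,v'}=a_{v',v}$: $\mathrm{sgn}(v,v')=1$ if $v\to v'$ and $-1$ if $v'\to v$. A configuration is a collection of vertex-disjoint directed cycles of even length $\ge4$ (two directions giving different configurations), doubled edges, and isolated vertices, covering each vertex exactly once. A loop $(v_0,\dots,v_{2k}=v_0)$ has weight $-\prod_{i=0}^{2k-1}\mathrm{sgn}(v_i,v_{i+1})a_{v_i,v_{i+1}}$ (a doubled edge $\{u,v\}$ has weight $a_{u,v}^2$); a configuration has weight the product of its loop weights and of $x(v)$ over isolated vertices; the partition function is the sum of the weights of all configurations. *)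

(* Defs.v *)
From HB Require Import structures.
From mathcomp Require Import all_boot all_order all_algebra.
From mathcomp Require Import boolp reals trigo.
From mathcomp Require Import zify.

Set Implicit Arguments.
Unset Strict Implicit.
Unset Printing Implicit Defensive.

Import Order.TTheory GRing.Theory Num.Theory.

Local Open Scope ring_scope.

(** ** The monopole-dimer (loop-vertex) model on an oriented graph *)

Section MonopoleDimer.
Variables (R : comNzRingType) (V : finType).
(* [adj] is the edge relation; [O u v] means that the edge uv is directed
   from u to v. *)
Variables (adj O : rel V) (x : V -> R) (a : V -> V -> R).

Definition is_orientation : Prop :=
  (forall u v, O u v -> adj u v) /\ (forall u v, adj u v -> O u v (+) O v u).

Definition sgn (u v : V) : R := if O u v then 1 else -1.

(* A directed cycle (v_0, ..., v_{k-1}, v_0) is identified with its set of arcs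
   (v_i, v_{i+1}), so that the choice of a starting point is immaterial. *)
Definition arcs (s : seq V) : {set V * V} :=
  [set e | (e.1 \in s) && (e.2 == next s e.1)].

(* Directed cycles of even length at least 4, together with the doubled edges,
   which are the cycles of length 2 (the two directions of a doubled edge give
   the same set of arcs {(u, v), (v, u)}). *)
Definition is_loop (l : {set V * V}) : bool :=
  `[< exists s : seq V, [/\ uniq s, (1 < size s)%N, ~~ odd (size s),
                           path.cycle adj s & l = arcs s] >].

Definition on_loop (v : V) (l : {set V * V}) : bool :=
  [exists w, (v, w) \in l].

(* C.1 is the set of loops and doubled edges of C, and C.2 is the set of its
   isolated vertices. *)
Definition is_config (C : {set {set V * V}} * {set V}) : bool :=
  [forall l in C.1, is_loop l] &&
  [forall v, #|[set l in C.1 | on_loop v l]| + (v \in C.2) == 1]%N.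

(* On a doubled edge uv this is (a u v) ^+ 2: see loop_weight_doubled. *)
Definition loop_weight (l : {set V * V}) : R :=
  - \prod_(e in l) (sgn e.1 e.2 * a e.1 e.2).

Definition config_weight (C : {set {set V * V}} * {set V}) : R :=
  (\prod_(l in C.1) loop_weight l) * (\prod_(v in C.2) x v).

Definition partition_function : R := \sum_(C | is_config C) config_weight C.

Lemma loop_weight_doubled (u v : V) :
  is_orientation -> (forall y z, a y z = a z y) -> adj u v -> u != v ->
  loop_weight (arcs [:: u; v]) = a u v ^+ 2.
Proof.
move=> [_ hO] ha huv neq.
have -> : arcs [:: u; v] = [set (u, v); (v, u)].
  apply/setP => -[y z]; rewrite !inE /= !xpair_eqE.
  have [->|nyu] := eqVneq y u; first by rewrite (negbTE neq) /= orbF.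
  by have [_|_] := eqVneq y v.
rewrite /loop_weight big_setU1 ?inE ?xpair_eqE ?(negbTE neq) // big_set1 /=.
rewrite /sgn (ha v u); have := hO _ _ huv.
by case: (O u v); case: (O v u) => // _;
  rewrite !mul1r !mulN1r ?mulrN ?mulNr opprK expr2.
Qed.

(* Number of edges of the closed walk u v w z u directed along each of its two
   traversal directions. *)
Definition clockwise_odd (u v w z : V) : bool :=
  odd (O u v + O v w + O w z + O z u)%N &&
  odd (O u z + O z w + O w v + O v u)%N.

End MonopoleDimer.

(** ** The three-dimensional Moebius grid graph *)

Section MoebiusGrid.
Variables n1 n2 n3 : nat.

(* The vertex (p, q, r) of [n1] x [n2] x [n3] is ((p - 1, q - 1), r - 1). *)
Definition gvertex : predArgType := ('I_n1 * 'I_n2 * 'I_n3)%type.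

Definition consecutive (i j : nat) : bool := (i.+1 == j) || (j.+1 == i).

Definition along1 : rel gvertex := fun u v =>
  [&& consecutive u.1.1 v.1.1, u.1.2 == v.1.2 & u.2 == v.2].
Definition along2 : rel gvertex := fun u v =>
  [&& u.1.1 == v.1.1, consecutive u.1.2 v.1.2 & u.2 == v.2].
Definition along3 : rel gvertex := fun u v =>
  [&& u.1.1 == v.1.1, u.1.2 == v.1.2 & consecutive u.2 v.2].

Definition solid : rel gvertex := fun u v =>
  [|| along1 u v, along2 u v | along3 u v].

Definition dashed_from (u v : gvertex) : bool :=
  [&& u.1.1 == 0 :> nat, v.1.1 == n1.-1 :> nat,
      v.1.2 == rev_ord u.1.2 & v.2 == rev_ord u.2].

Definition dashed : rel gvertex := fun u v =>
  dashed_from u v || dashed_from v u.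

Definition moebius : rel gvertex := fun u v => solid u v || dashed u v.

Definition moebius_weight (R : Type) (a1 a2 a3 : R) (u v : gvertex) : R :=
  if along1 u v || dashed u v then a1 else if along2 u v then a2 else a3.

End MoebiusGrid.

(** ** Boustrophedon labelling and orientation *)

Section Boustrophedon.
Variables m1 m2 m3 : nat.
Local Notation vertex := (gvertex (2 * m1) (2 * m2) (2 * m3)).

(* Here q./2 and r./2 are the integers s and t with q = 2s or q = 2s + 1, and
   r = 2t or r = 2t + 1.  For 1 <= p <= 2 m1, 1 <= q <= 2 m2, 1 <= r the
   subtractions are never truncated. *)
Definition boustrophedon (p q r : nat) : nat :=
  let s := q./2 in let t := r./2 in
  match odd q, odd r with
  | true, true => 8 * t * m1 * m2 + 4 * s * m1 + p
  | false, true => (8 * t * m1 * m2 + 4 * s * m1 + 1) - p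
  | true, false => (8 * t * m1 * m2 + 1) - (4 * s * m1 + p)
  | false, false => (8 * t * m1 * m2 + p) - 4 * s * m1
  end%N.

Definition label (v : vertex) : nat :=
  boustrophedon v.1.1.+1 v.1.2.+1 v.2.+1.

Definition moebius_orientation (O : rel vertex) : Prop :=
  [/\ is_orientation (@moebius _ _ _) O,
      forall u v, solid u v -> O u v = (label u < label v)%N,
      forall u v, dashed u v -> label u = 1%N -> O u v &
      forall u v w z, solid u v -> dashed v w -> solid w z -> dashed z u ->
        clockwise_odd O u v w z].

Lemma labelE (u : vertex) :
  label u = ((u.2 * (2 * m2) + (if odd u.2 then rev_ord u.1.2 else u.1.2))
              * (2 * m1)
            + (if odd u.1.2 (+) odd u.2 then rev_ord u.1.1 else u.1.1)).+1%N.
Proof.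
case: u => [[[p hp] [q hq]] [r hr]]; rewrite /label /boustrophedon /=.
rewrite !uphalf_half.
have := odd_double_half r; have := odd_double_half q; rewrite -!muln2.
move: (q./2) (r./2) => s t.
case: (odd q); case: (odd r) => /= Eq Er; subst q r; rewrite ?add0n in hq hr *.
- nia.
- nia.
- nia.
- nia.
Qed.

(* Such an orientation exists: a dashed edge leaves its endpoint (p, q, r) iff
   q is odd (i.e. iff the index q - 1 is even). *)
Lemma moebius_orientation_exists : exists O : rel vertex, moebius_orientation O.
Proof.
have L1 (u v : vertex) : along1 u v ->
    (label u < label v)%N =
    ((u.1.1 < v.1.1)%N == (odd u.1.2 == odd u.2)).
  rewrite !labelE; case: u v => [[[p hp] q] r] [[[p' hp'] q'] r'] /=.
  rewrite /along1 /consecutive /= => /and3P[+ /eqP <- /eqP <-].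
  by case: (odd q); case: (odd r) => /=; lia.
have lex (k A B a b : nat) : (a < k)%N -> (b < k)%N -> A <> B ->
   (A * k + a < B * k + b)%N = (A < B)%N by nia.
have L2 (u v : vertex) : along2 u v ->
    (label u < label v)%N = ((u.1.2 < v.1.2)%N == ~~ odd u.2).
  rewrite !labelE; case: u v => [[p [q hq]] r] [[p' [q' hq']] r'] /=.
  rewrite /along2 /consecutive /= => /and3P[/eqP <- h /eqP <-].
  rewrite ltnS lex; do ?by case: ifP => _; apply: ltn_ord.
    by case: (odd r) => /=; lia.
  by case: (odd r) => /=; lia.
have L3 (u v : vertex) : along3 u v ->
    (label u < label v)%N = (u.2 < v.2)%N.
  rewrite !labelE; case: u v => [[p q] [r hr]] [[p' q'] [r' hr']] /=.
  rewrite /along3 /consecutive /= => /and3P[/eqP <- /eqP <- h].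
  have hA : ((if odd r then rev_ord q else q) < 2 * m2)%N.
    by case: ifP => _; apply: ltn_ord.
  have hB : ((if odd r' then rev_ord q else q) < 2 * m2)%N.
    by case: ifP => _; apply: ltn_ord.
  rewrite ltnS lex; do ?by case: ifP => _; apply: ltn_ord.
    by rewrite lex //; lia.
  have ne : r <> r' by lia.
  by move=> E; have := lex _ _ _ _ _ hA hB ne;
    have := lex _ _ _ _ _ hB hA (nesym ne); rewrite E ltnn; lia.
pose O (u v : vertex) :=
  if dashed u v then ~~ odd u.1.2 else solid u v && (label u < label v)%N.
have rev_odd n (i : 'I_(2 * n)) : odd (rev_ord i) = ~~ odd i.
  by case: i => i hi /=; lia.
have dashedE (u v : vertex) : dashed u v ->
    [/\ v.1.2 = rev_ord u.1.2 , v.2 = rev_ord u.2 & dashed v u].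
  rewrite /dashed => /orP[] h; move: (h) => /and4P[_ _ /eqP-> /eqP->];
    by rewrite ?rev_ordK h ?orbT.
have consC (i j : nat) : consecutive i j = consecutive j i by exact: orbC.
have C1 (u v : vertex) : along1 u v = along1 v u.
  by rewrite /along1 consC !(eq_sym u.1.2) !(eq_sym u.2).
have C2 (u v : vertex) : along2 u v = along2 v u.
  by rewrite /along2 consC !(eq_sym u.1.1) !(eq_sym u.2).
have C3 (u v : vertex) : along3 u v = along3 v u.
  by rewrite /along3 consC !(eq_sym u.1.1) !(eq_sym u.1.2).
have solidC (u v : vertex) : solid u v -> solid v u.
  by rewrite /solid C1 C2 C3.
have sdF (u v : vertex) : solid u v -> dashed u v = false.
  move=> hs; apply/negP => /dashedE[e2 e3 _]; move: hs.
  have o2 := rev_odd _ u.1.2; have o3 := rev_odd _ u.2.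
  rewrite /solid /along1 /along2 /along3 e2 e3.
  case/or3P => /and3P[h1 h2 h3].
  - by move/eqP: h2 o2 => <-; case: (odd _).
  - by move/eqP: h3 o3 => <-; case: (odd _).
  - by move/eqP: h2 o2 => <-; case: (odd _).
have lneq (u v : vertex) : solid u v ->
    (label u < label v)%N (+) (label v < label u)%N.
  case/or3P => h.
  - rewrite (L1 _ _ h) L1 1?C1 //.
    by case/and3P: h => + /eqP <- /eqP <-; rewrite /consecutive; lia.
  - rewrite (L2 _ _ h) L2 1?C2 //.
    by case/and3P: h => _ + /eqP <-; rewrite /consecutive; lia.
  - rewrite (L3 _ _ h) L3 1?C3 //.
    by case/and3P: h => _ _; rewrite /consecutive; lia.
exists O; split.
- split=> u v; rewrite /O /moebius.
    by case: ifP => [_ _|_ /andP[->]]; rewrite ?orbT.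
  case/orP => h.
    by rewrite (sdF _ _ h) (sdF _ _ (solidC _ _ h)) h (solidC _ _ h) lneq.
  by have [e2 _ h'] := dashedE _ _ h; rewrite h h' e2 rev_odd; case: (odd _).
- by move=> u v h; rewrite /O sdF // h.
- move=> u v h; rewrite /O h.
  rewrite labelE => -[].
  have := ltn_ord u.1.1; have := ltn_ord u.1.2.
  case: u {h} => -[p q] r /= hq hp /eqP.
  rewrite addn_eq0 muln_eq0 addn_eq0 muln_eq0.
  by case: ifP; lia.
- move=> u v w z uv vw wz zu.
  have [w2 w3 wv] := dashedE _ _ vw; have [u2 u3 uz] := dashedE _ _ zu.
  have ow2 := rev_odd _ v.1.2; have ow3 := rev_odd _ v.2.
  have ou2 := rev_odd _ z.1.2; have ou3 := rev_odd _ z.2.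
  rewrite -w2 in ow2; rewrite -w3 in ow3.
  rewrite -u2 in ou2; rewrite -u3 in ou3.
  have vu := solidC _ _ uv; have zw := solidC _ _ wz.
  rewrite /clockwise_odd /O vw wv zu uz !sdF // uv wz vu zw /=.
  have := lneq _ _ uv; have := lneq _ _ wz.
  have [vw1 zu1] : (v.1.1 + w.1.1 = (2 * m1).-1)%N /\
                   (z.1.1 + u.1.1 = (2 * m1).-1)%N.
    by split; [move: vw | move: zu] => /orP[] /and4P[/eqP-> /eqP-> _ _];
      rewrite ?addn0 ?add0n.
  have rev_sum n (i : 'I_n) : (i + rev_ord i)%N = n.-1.
    by case: n i => [[]|n] // i; rewrite /= subSS subnKC // -ltnS.
  have vw2 := rev_sum _ v.1.2; have vw3 := rev_sum _ v.2.
  have zu2 := rev_sum _ z.1.2; have zu3 := rev_sum _ z.2.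
  rewrite -w2 in vw2; rewrite -w3 in vw3.
  rewrite -u2 in zu2; rewrite -u3 in zu3.
  have A1 (y t : vertex) : along1 y t =
    [&& consecutive y.1.1 t.1.1, y.1.2 == t.1.2 :> nat & y.2 == t.2 :> nat].
    by [].
  have A2 (y t : vertex) : along2 y t =
    [&& y.1.1 == t.1.1 :> nat, consecutive y.1.2 t.1.2 & y.2 == t.2 :> nat].
    by [].
  have A3 (y t : vertex) : along3 y t =
    [&& y.1.1 == t.1.1 :> nat, y.1.2 == t.1.2 :> nat & consecutive y.2 t.2].
    by [].
  have key : ((label u < label v) == (label w < label z))%N =
             (odd u.1.2 == odd v.1.2).
  { case/or3P: uv => uv; case/or3P: wz => wz.
    1: rewrite (L1 _ _ uv) (L1 _ _ wz).
    5: rewrite (L2 _ _ uv) (L2 _ _ wz).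
    9: rewrite (L3 _ _ uv) (L3 _ _ wz).
    all: move: uv wz vw1 zu1 vw2 zu2 vw3 zu3 ow2 ow3.
    all: rewrite ?A1 ?A2 ?A3 /consecutive; clear.
    all: move: (nat_of_ord u.1.1) (nat_of_ord u.1.2) (nat_of_ord u.2).
    all: move: (nat_of_ord v.1.1) (nat_of_ord v.1.2) (nat_of_ord v.2).
    all: move: (nat_of_ord w.1.1) (nat_of_ord w.1.2) (nat_of_ord w.2).
    all: move: (nat_of_ord z.1.1) (nat_of_ord z.1.2) (nat_of_ord z.2).
    all: move=> zp zq zr wp wq wr vp vq vr up uq ur
      /and3P[c1 c2 c3] /and3P[d1 d2 d3].
    2,3,4,6,7,8: by move=> *; exfalso; lia.
    - move/eqP: c2 => ->; move/eqP: c3 => -> e1 e2 _ _ _ _ -> ->.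
      have -> : (wp < zp)%N = (up < vp)%N.
        by clear -c1 e1 e2 d1; lia.
      by case: (_ < _)%N; case: (odd vq); case: (odd vr).
    - move/eqP: c3 => -> _ _ e1 e2 _ _ _ ->.
      have -> : odd uq = ~~ odd vq by clear -c2; lia.
      have -> : (wq < zq)%N = (uq < vq)%N by clear -c2 e1 e2 d2; lia.
      by case: (_ < _)%N; case: (odd vq); case: (odd vr).
    - move/eqP: c2 => -> _ _ _ _ e1 e2 _ _.
      have -> : (wr < zr)%N = (ur < vr)%N by clear -c3 e1 e2 d3; lia.
      by rewrite !eqxx. }
  move: key; rewrite ow2 ou2.
  case: (label u < label v)%N; case: (label v < label u)%N;
  case: (label w < label z)%N; case: (label z < label w)%N;
  by case: (odd v.1.2); case: (odd z.1.2).
Qed.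

End Boustrophedon.

(* Main.v *)
Require Import Defs.
From HB Require Import structures.
From mathcomp Require Import all_boot all_order all_algebra.
From mathcomp Require Import fingroup perm.
From mathcomp Require Import boolp reals trigo.
From mathcomp Require Import complex.
From mathcomp Require Import zify ring lra.

(** In a bipartite graph every permutation with nonzero weight has only fixed
points and even cycles, so the partition function is the determinant of the
signed weighted adjacency matrix K.  The clockwise-odd squares force each dashed
edge to leave its endpoint (p, q, r) with q odd.  Writing T for the signed path
operator, S for the diagonal of alternating signs, J for the reversal and E for
the two corner entries,
  K = x + a1 (T(x)S(x)S + E(x)SJ(x)J) + a2 1(x)T(x)S + a3 1(x)1(x)T,
where the three skew-symmetric terms anticommute.  Transposition gives
det(K)^2 = det(x^2 - (K - x)^2), and (K - x)^2 is diagonalised over the complex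
numbers by tensors of a geometric sequence z^p with z^(2 m1) = +i or -i, a
combination of two sine vectors, and a sine vector.  Both sides of the claim are
then monic polynomials in x with the same square. *)

Set Implicit Arguments.
Unset Strict Implicit.
Unset Printing Implicit Defensive.

Import Order.TTheory GRing.Theory Num.Theory.

Local Open Scope ring_scope.

(** * The partition function as a determinant *)

(** The dashed edges reverse the other two coordinates, so the first-direction term is not a single
    tensor and the problem is to separate the variables. As [S] anticommutes with [T] and with [J],
    the square of that term has [T^2 - E^2] on the first factor alone, plus [TE + ET] tensored with
    [J] and [SJ]. Hence the square of the skew part preserves the eigenspaces of [J] in the second
    direction and of [SJ] in the third. Where these have eigenvalues [d] and [eta], with [d^2 = 1]
    and [eta^2 = -1], the first factor becomes [(T + d eta E)^2]: a path closed up with twist [i] or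
    [-i], which geometric sequences diagonalise. In the third direction the sine eigenvectors of [T]
    are already eigenvectors of [SJ]. In the second, [J] anticommutes with [T] and exchanges
    opposite eigenvalues, so eigenvectors of [T] have to be paired; only [T^2] keeps them, which is
    all the square needs. *)

Section PermCycles.
Variables (T : finType) (s : {perm T}).

Lemma mem_porbit_fconnect (v w : T) : (w \in porbit s v) = fconnect s v w.
Proof.
apply/porbitP/idP => [[i ->]|h]; first by rewrite permX fconnect_iter.
by exists (findex s v w); rewrite permX iter_findex.
Qed.

Lemma fcycle_traject_porbit (v : T) : fcycle s (traject s v #|porbit s v|).
Proof.
have := iter_porbit s v.
case: #|porbit s v| (card_porbit_neq0 s v) => // k _ hk.
by have := fpath_traject s v k.+1; rewrite trajectSr -iterSr hk.
Qed.

Lemma next_traject_porbit (v w : T) :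
  w \in porbit s v -> next (traject s v #|porbit s v|) w = s w.
Proof.
rewrite porbit_traject => hw.
by have /eqP -> := next_cycle (fcycle_traject_porbit v) hw.
Qed.

Lemma card_porbit_gt1 (v : T) : (1 < #|porbit s v|)%N = (s v != v).
Proof.
have hs : s v \in porbit s v by exact: (mem_porbit s 1).
apply/idP/idP => [h|h].
  apply/negP => /eqP e; have := iter_porbit s v; move: h.
  have: porbit s v \subset [set v].
    apply/subsetP => w /porbitP[i ->]; rewrite permX inE.
    by elim: i => //= i /eqP ->; rewrite e.
  by move/subset_leq_card; rewrite cards1; case: #|_| => [|[]].
have: [set v; s v] \subset porbit s v.
  by apply/subsetP => w; rewrite !inE => /orP[] /eqP -> //; exact: porbit_id.
by move/subset_leq_card; rewrite cards2 eq_sym h.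
Qed.

Lemma porbit_fix (v w : T) : s v = v -> w \in porbit s v -> w = v.
Proof.
move=> e /porbitP[i ->]; rewrite permX.
by elim: i => //= i ->.
Qed.

End PermCycles.

(** * Correspondence between permutations and configurations *)

Section LoopVertexDeterminant.
Variables (R : comNzRingType) (V : finType).
Variables (adj O : rel V) (x : V -> R) (a : V -> V -> R).

(** The Leibniz sum over permutations of [V] itself, so that configurations and permutations are
    compared without enumerating [V]. *)
Definition detf (A : V -> V -> R) : R :=
  \sum_(s : {perm V}) (-1) ^+ s * \prod_v A v (s v).

Definition signed_adjacency (u v : V) : R :=
  if u == v then x u else if adj u v then sgn R O u v * a u v else 0.

Variable col : V -> bool.
Hypothesis col_adj : forall u v, adj u v -> col u != col v.

Local Notation K := signed_adjacency.

Definition admissible (s : {perm V}) := [forall v, (s v == v) || adj v (s v)].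

Definition perm_arcs (s : {perm V}) (X : {set V}) : {set V * V} :=
  [set e | (e.1 \in X) && (e.2 == s e.1)].

(** Orbits of size two become doubled edges and longer orbits directed cycles, so a cycle and its
    reverse come from different permutations. *)
Definition config_of (s : {perm V}) : {set {set V * V}} * {set V} :=
  ([set perm_arcs s X | X in [set X in porbits s | 1 < #|X|]%N],
   [set v | s v == v]).

Lemma adj_irrefl v : adj v v = false.
Proof. by apply/negP => /col_adj; rewrite eqxx. Qed.

Lemma col_path v p : path adj v p -> col (last v p) = col v (+) odd (size p).
Proof.
elim: p v => [|w p IH] v /=; first by rewrite addbF.
case/andP => /col_adj h /IH ->.
by case: (col v) (col w) h => [] [] //= _; case: (odd _).
Qed.

Lemma even_cycle p : path.cycle adj p -> ~~ odd (size p).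
Proof.
case: p => //= v p /col_path.
rewrite last_rcons size_rcons /=.
by case: (col v); case: (odd _).
Qed.

Lemma arcs_next (p : seq V) v : v \in p -> (v, next p v) \in arcs p.
Proof. by move=> h; rewrite inE /= h eqxx. Qed.

Lemma on_loop_arcs (p : seq V) v : on_loop v (arcs p) = (v \in p).
Proof.
apply/existsP/idP => [[w]|h]; first by rewrite inE => /andP[].
by exists (next p v); exact: arcs_next.
Qed.

Lemma perm_arcs_dom s (X : {set V}) v : on_loop v (perm_arcs s X) = (v \in X).
Proof.
apply/existsP/idP => [[w]|h]; first by rewrite inE => /andP[].
by exists (s v); rewrite inE /= h eqxx.
Qed.

Lemma perm_arcs_inj s : injective (perm_arcs s).
Proof. by move=> X Y e; apply/setP => v; rewrite -!(perm_arcs_dom s) e. Qed.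

Lemma perm_arcs_traject s v :
  perm_arcs s (porbit s v) = arcs (traject s v #|porbit s v|).
Proof.
apply/setP => -[w z]; rewrite !inE -porbit_traject /=.
by case h : (w \in porbit s v); rewrite //= next_traject_porbit.
Qed.

Lemma porbit_cycle (s : {perm V}) (p : seq V) v :
  fcycle s p -> v \in p -> perm_arcs s (porbit s v) = arcs p.
Proof.
move=> hc hv; apply/setP => -[w z]; rewrite !inE /=.
rewrite mem_porbit_fconnect (fconnect_cycle hc hv).
by case h : (w \in p) => //=; have /eqP <- := next_cycle hc h.
Qed.

Lemma admissible_cycle s v : admissible s -> s v != v ->
  path.cycle adj (traject s v #|porbit s v|).
Proof.
move=> /forallP hs nv.
have inX : all (mem (porbit s v)) (traject s v #|porbit s v|).
  by apply/allP => w; rewrite -porbit_traject.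
apply: sub_in_cycle inX (fcycle_traject_porbit s v) => w z /=.
move=> hw _ /eqP <-; have := hs w; case: eqP => //= e.
have hw' : w \in porbit s v by exact: hw.
rewrite porbit_sym in hw'.
by move: nv; rewrite (porbit_fix e hw') e eqxx.
Qed.

(** The permutation can be read off: the only arc leaving a non-fixed [v] is [(v, s v)]. *)
Lemma config_of_inj : injective config_of.
Proof.
move=> s t e; apply/permP => v.
have [h|h] := boolP (s v == v).
  have : v \in (config_of s).2 by rewrite inE.
  by rewrite e inE (eqP h) => /eqP.
have : perm_arcs s (porbit s v) \in (config_of s).1.
  by apply: imset_f; rewrite inE card_porbit_gt1 h andbT imset_f.
rewrite e => /imsetP[Y _ eY].
have : (v, s v) \in perm_arcs s (porbit s v) by rewrite inE /= porbit_id eqxx.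
by rewrite eY inE /= => /andP[_ /eqP].
Qed.

Lemma config_of_config s : admissible s -> is_config adj (config_of s).
Proof.
move=> hs; apply/andP; split.
  apply/forallP => l; apply/implyP => /imsetP[X].
  rewrite inE => /andP[/imsetP[v _ ->{X}]] hc ->.
  apply/asboolP; exists (traject s v #|porbit s v|).
  have hcyc := admissible_cycle hs (etrans (esym (card_porbit_gt1 s v)) hc).
  rewrite size_traject; split => //; first exact: uniq_traject_porbit.
    by rewrite -[#|_|](size_traject s v); exact: even_cycle.
  exact: perm_arcs_traject.
apply/forallP => v; rewrite inE.
have [h|h] := boolP (s v == v).
  rewrite (_ : [set _ | _ & _] = set0) ?cards0 //.
  apply/setP => l; rewrite !inE; apply/negP => /andP[/imsetP[X]].
  rewrite inE => /andP[/imsetP[w _ ->{X}]] hc ->.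
  rewrite perm_arcs_dom -eq_porbit_mem => /eqP e.
  by move: hc; rewrite -e card_porbit_gt1 h.
rewrite (_ : [set _ | _ & _] = [set perm_arcs s (porbit s v)]) ?cards1 //.
apply/setP => l; rewrite !inE; apply/andP/eqP => [[/imsetP[X]]|->].
  rewrite inE => /andP[/imsetP[w _ ->{X}]] hc ->.
  by rewrite perm_arcs_dom -eq_porbit_mem => /eqP ->.
rewrite perm_arcs_dom porbit_id; split => //.
by apply: imset_f; rewrite inE card_porbit_gt1 h andbT imset_f.
Qed.

(** The permutation sends each vertex to its successor on the unique loop through it. *)
Lemma config_of_surj C : is_config adj C ->
  exists2 s, admissible s & config_of s = C.
Proof.
move=> /andP[/forall_inP hl /forallP hC].
have loopP l : l \in C.1 -> exists p, [/\ uniq p, (1 < size p)%N,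
     path.cycle adj p & l = arcs p].
  by move/hl/asboolP => [p [h1 h2 _ h3 h4]]; exists p.
have uniql v l l' : l \in C.1 -> l' \in C.1 -> on_loop v l -> on_loop v l' ->
    l = l'.
  move=> h h' o o'; apply/eqP/negPn/negP => ne.
  have := hC v; have : [set l; l'] \subset [set l in C.1 | on_loop v l].
    by apply/subsetP => z; rewrite !inE => /orP[] /eqP ->; rewrite ?h ?h' ?o ?o'.
  by move/subset_leq_card; rewrite cards2 ne; case: #|_| => [|[]].
have isol v l : l \in C.1 -> on_loop v l -> v \notin C.2.
  move=> h o; apply/negP => hv; have := hC v; rewrite hv (cardsD1 l) !inE h o /=.
  by case: #|_|.
have nisol v : v \notin C.2 -> exists2 l, l \in C.1 & on_loop v l.
  move=> hv; have := hC v; rewrite (negbTE hv) addn0 => /cards1P[l e].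
  have : l \in [set l] by rewrite inE.
  by rewrite -e inE => /andP[]; exists l.
pose r v w := [exists l in C.1, (v, w) \in l].
(* The default [v] fixes the isolated vertices, which no arc leaves. *)
pose f v := odflt v [pick w | r v w].
have rP v w : r v w -> exists p, [/\ uniq p, path.cycle adj p, arcs p \in C.1,
    v \in p & w = next p v].
  move=> /exists_inP[l lC]; have [p [up _ cp e]] := loopP _ lC.
  rewrite e inE /= => /andP[vp /eqP ->]; exists p; split=> //.
  by rewrite -e.
have fP v : (v \in C.2) && (f v == v) || (v \notin C.2) && r v (f v).
  have [hv|/nisol[l lC]] := boolP (v \in C.2); rewrite /f.
    case: pickP => [w /rP[p [_ _ pC vp _]]|_] /=; last by rewrite eqxx.
    by have := isol v _ pC; rewrite on_loop_arcs vp hv => /(_ isT).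
  move=> /existsP[w hw]; case: pickP => [//|/(_ w)] /=.
  by have -> : r v w by apply/exists_inP; exists l.
have r_out v w : r v w -> w \notin C.2.
  move=> /rP[p [up cp pC vp ->]]; apply: isol pC _.
  by rewrite on_loop_arcs mem_next.
have finj : injective f.
  move=> v v' e; have := fP v; have := fP v'; rewrite -e.
  case/orP => /andP[h1 h2]; case/orP => /andP[h3 h4].
  - by rewrite -(eqP h4) (eqP h2).
  - by move/r_out: h4; rewrite (eqP h2) h1.
  - by move/r_out: h2; rewrite (eqP h4) h3.
  (* Both loops pass through the common image, hence coincide, and the predecessor on a loop is
     unique. *)
  - have [p [up _ pC vp e1]] := rP _ _ h4.
    have [q [uq _ qC vq e2]] := rP _ _ h2.
    have epq : arcs p = arcs q.
      apply: (uniql (f v)) => //; first by rewrite on_loop_arcs e1 mem_next.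
      by rewrite on_loop_arcs e2 mem_next.
    have vp' : v' \in p by rewrite -on_loop_arcs epq on_loop_arcs.
    have := arcs_next vq; rewrite -epq inE /= vp' -e2 e1 /= => /eqP h.
    by rewrite -(prev_next up v) h prev_next.
pose s := perm finj.
have sE v : s v = f v by rewrite permE.
have sfix v : (s v == v) = (v \in C.2).
  rewrite sE; have := fP v; case/orP => /andP[h1 h2]; first by rewrite h1 h2.
  rewrite (negbTE h1); apply/negP => /eqP e.
  have [p [_ cp _ vp e1]] := rP _ _ h2.
  by have := next_cycle cp vp; rewrite -e1 e adj_irrefl.
have s_next p : arcs p \in C.1 -> uniq p -> fcycle s p.
  move=> pC up; apply: sub_in_cycle (allss p) (cycle_next up).
  move=> v w vp _ /=; rewrite /frel /= => /eqP <-; apply/eqP; rewrite sE.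
  have := fP v; have := isol v _ pC; rewrite on_loop_arcs => /(_ vp) hv.
  rewrite hv (negbTE hv) /= => /rP[q [uq _ qC vq ->]].
  have e : arcs p = arcs q by apply: (uniql v) => //; rewrite on_loop_arcs.
  by have := arcs_next vq; rewrite -e inE /= => /andP[_ /eqP ->].
exists s.
  apply/forallP => v; rewrite sfix; have := fP v.
  case/orP => /andP[h1 h2]; first by rewrite h1.
  have [p [_ cp _ vp e]] := rP _ _ h2.
  by rewrite sE e (next_cycle cp vp) orbT.
apply: injective_projections => /=; last by apply/setP => v; rewrite inE sfix.
apply/setP => l; apply/imsetP/idP => [[X]|lC].
  rewrite inE => /andP[/imsetP[v _ ->{X}]].
  rewrite card_porbit_gt1 sfix => /nisol[l' lC hv] ->.
  have [p [up _ cp e]] := loopP _ lC.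
  rewrite e on_loop_arcs in hv lC.
  by rewrite (porbit_cycle (s_next _ lC up) hv).
have [p [up sp cp e]] := loopP _ lC; rewrite e in lC *.
have [v vp] : exists v, v \in p.
  by case: p sp {up cp e lC} => // v p _; exists v; rewrite mem_head.
exists (porbit s v); last by rewrite (porbit_cycle (s_next _ lC up) vp).
rewrite inE imset_f //= card_porbit_gt1 sfix.
by apply: isol lC _; rewrite on_loop_arcs.
Qed.

(** The sign is the parity of [#|V|] plus the number of orbits, and both are sums over the
    orbits. *)
Lemma porbits_sign (s : {perm V}) :
  (-1) ^+ s = \prod_(X in porbits s) (-1) ^+ #|X|.+1 :> R.
Proof.
have cardV : #|V| = (\sum_(X in porbits s) #|X|)%N.
  rewrite -sum1_card (partition_big_imset (porbit s)) /=.
  apply: eq_bigr => _ /imsetP[v _ ->]; rewrite -sum1_card.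
  by apply: eq_bigl => w; rewrite eq_porbit_mem.
rewrite prodrXr; under eq_bigr do rewrite -addn1.
by rewrite big_split /= -cardV sum1_card -[RHS]signr_odd oddD.
Qed.

(** The two-colouring makes the orbit even, hence of sign -1, and this is the minus sign in the
    weight of a loop. *)
Lemma loop_weight_perm_arcs s v : admissible s -> s v != v ->
  loop_weight O a (perm_arcs s (porbit s v))
  = (-1) ^+ #|porbit s v|.+1 * \prod_(w in porbit s v) K w (s w).
Proof.
move=> hs nv.
have := even_cycle (admissible_cycle hs nv); rewrite size_traject => hev.
rewrite exprS -signr_odd (negbTE hev) expr0 mulr1 mulN1r /loop_weight.
congr (- _).
have -> : perm_arcs s (porbit s v) = [set (w, s w) | w in porbit s v].
  apply/setP => -[w z]; rewrite inE /=; apply/andP/imsetP => [[h /eqP ->]|].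
    by exists w.
  by move=> [w' h [-> ->]].
rewrite big_imset /=; last by move=> w w' _ _ [].
apply: eq_bigr => w hw; rewrite /K.
have nw : s w != w.
  rewrite porbit_sym in hw; apply: contra nv => /eqP e.
  by rewrite (porbit_fix e hw) e.
rewrite eq_sym (negbTE nw).
by move/forallP: hs => /(_ w); rewrite (negbTE nw) /= => ->.
Qed.

Lemma config_of_weight s : admissible s ->
  config_weight O x a (config_of s) = (-1) ^+ s * \prod_v K v (s v).
Proof.
move=> hs; rewrite porbits_sign.
rewrite (partition_big_imset (porbit s)) /= -big_split /=.
rewrite (bigID (fun X : {set V} => 1 < #|X|)%N) /=; congr (_ * _).
  rewrite /config_of big_imset /=; last by move=> ? ? _ _ /perm_arcs_inj.
  under eq_bigl do rewrite inE.
  apply: eq_bigr => X /andP[/imsetP[v _ ->]]; rewrite card_porbit_gt1 => nv.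
  rewrite loop_weight_perm_arcs //; congr (_ * _); apply: eq_bigl => w.
  by rewrite eq_porbit_mem.
(* The remaining orbits are singletons, with sign [(-1)^2] and weight [x v]. *)
rewrite [RHS](_ : _ = \prod_(X in [set porbit s v | v in [set v | s v == v]])
   ((-1) ^+ #|X|.+1 * \prod_(i | porbit s i == X) K i (s i))).
  rewrite big_imset /=.
    apply: eq_big => v; first by rewrite !inE.
    rewrite inE => /eqP e; have -> : porbit s v = [set v].
      apply/setP => w; rewrite inE; apply/idP/eqP => [/(porbit_fix e)//|->].
      exact: porbit_id.
    rewrite cards1 expr2 mulrNN !mul1r (big_pred1 v) /K ?e ?eqxx // => w /=.
    apply/eqP/eqP => [ew|->].
      have := porbit_id s w; rewrite ew inE => /eqP //.
    apply/setP => u; rewrite inE; apply/idP/eqP => [/(porbit_fix e)//|->].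
    exact: porbit_id.
  move=> v w; rewrite !inE => /eqP e /eqP e' h.
  by apply: (porbit_fix e'); rewrite -h porbit_id.
apply: eq_bigl => X; apply/andP/imsetP => [[/imsetP[v _ ->]]|[v]].
  by rewrite card_porbit_gt1 negbK => h; exists v; rewrite ?inE.
by rewrite inE => h ->; rewrite imset_f // card_porbit_gt1 h.
Qed.

Lemma partition_function_det :
  partition_function adj O x a = detf K.
Proof.
rewrite /partition_function /detf (bigID admissible) /= [X in _ + X]big1 ?addr0.
  rewrite (eq_bigl (mem (config_of @: [pred s | admissible s]))).
    rewrite big_imset /=; last by move=> ? ? _ _ /config_of_inj.
    by apply: eq_bigr => s; exact: config_of_weight.
  move=> C; apply/idP/imsetP => [/config_of_surj[s hs <-]|[s hs ->]].
    by exists s.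
  exact: config_of_config.
move=> s; rewrite negb_forall => /existsP[v].
rewrite negb_or => /andP[h1 h2]; rewrite (bigD1 v) //= /K.
by rewrite eq_sym (negbTE h1) (negbTE h2) mul0r mulr0.
Qed.

End LoopVertexDeterminant.

(** * Matrices indexed by finite types *)

Section PermTransport.
Variables (T T' : finType) (f : T -> T') (g : T' -> T).
Hypotheses (fK : cancel f g) (gK : cancel g f).

Lemma perm_transport_subproof (s : {perm T}) : injective (fun y => f (s (g y))).
Proof. by move=> y z /(can_inj fK)/perm_inj/(can_inj gK). Qed.

(** Conjugation by a bijection; it carries the Leibniz sum indexed by [V] to the ordinal-indexed
    [\det]. *)
Definition perm_transport s := perm (@perm_transport_subproof s).

Lemma perm_transportE s y : perm_transport s y = f (s (g y)).
Proof. by rewrite permE. Qed.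

Lemma odd_perm_transport s : odd_perm (perm_transport s) = odd_perm s.
Proof.
rewrite /odd_perm (bij_eq_card (Bijective gK fK)); congr (_ (+) odd _).
have imE v : porbit (perm_transport s) (f v) = f @: porbit s v.
  have powE i u : (perm_transport s ^+ i)%g (f u) = f ((s ^+ i)%g u).
    rewrite !permX; elim: i => //= i ->.
    by rewrite perm_transportE fK.
  apply/setP => y; apply/porbitP/imsetP => [[i ->]|[w /porbitP[i ->] ->]].
    by exists ((s ^+ i)%g v); rewrite ?powE ?mem_porbit.
  by exists i; rewrite powE.
rewrite -(card_imset (porbits s) (imset_inj (can_inj fK))).
apply: eq_card => X; apply/imsetP/imsetP => [[y _ ->]|[_ /imsetP[v _ ->] ->]].
  exists (porbit s (g y)); first exact: imset_f.
  by rewrite -imE gK.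
by exists (f v); rewrite ?imE.
Qed.

End PermTransport.

Lemma perm_transport_bij (T T' : finType) (f : T -> T') (g : T' -> T)
  (fK : cancel f g) (gK : cancel g f) : bijective (perm_transport fK gK).
Proof.
by exists (perm_transport gK fK) => s; apply/permP => y;
  rewrite !perm_transportE ?fK ?gK.
Qed.

Section FunctionMatrices.
Variables (F : comNzRingType) (V : finType).

Definition mxf (A : V -> V -> F) : 'M[F]_#|V| :=
  \matrix_(i, j) A (enum_val i) (enum_val j).

Lemma detf_mxf A : detf A = \det (mxf A).
Proof.
rewrite /determinant /detf.
rewrite (reindex _ (onW_bij _ (perm_transport_bij (@enum_rankK V) (@enum_valK V)))).
apply: eq_bigr => s _; rewrite odd_perm_transport; congr (_ * _).
rewrite (reindex (@enum_val V V)) /=; last first.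
  by apply: onW_bij; exists enum_rank; [exact: enum_valK | exact: enum_rankK].
by apply: eq_bigr => i _; rewrite mxE perm_transportE enum_rankK.
Qed.

Definition ap (A : V -> V -> F) (f : V -> F) (u : V) := \sum_v A u v * f v.

Lemma sum_enum_val (h : V -> F) : \sum_v h v = \sum_(i < #|V|) h (enum_val i).
Proof.
rewrite (reindex (@enum_val V V)) //=.
by apply: onW_bij; exists enum_rank; [exact: enum_valK | exact: enum_rankK].
Qed.

Lemma prod_enum_val (h : V -> F) :
  \prod_v h v = \prod_(i < #|V|) h (enum_val i).
Proof.
rewrite (reindex (@enum_val V V)) //=.
by apply: onW_bij; exists enum_rank; [exact: enum_valK | exact: enum_rankK].
Qed.

Lemma mxf_mul A B :
  mxf A *m mxf B = mxf (fun u w => ap A (fun v => B v w) u).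
Proof.
apply/matrixP => i j; rewrite !mxE /ap sum_enum_val.
by apply: eq_bigr => k _; rewrite !mxE.
Qed.

Lemma mxf_diag d :
  mxf (fun u v => (u == v)%:R * d v) = diag_mx (\row_i d (enum_val i)).
Proof.
apply/matrixP => i j; rewrite !mxE (inj_eq enum_val_inj).
by case: eqP => [->|]; rewrite ?mul1r ?mul0r.
Qed.

Lemma det_mxf_diag d :
  \det (mxf (fun u v => (u == v)%:R * d v)) = \prod_v d v.
Proof.
by rewrite mxf_diag det_diag prod_enum_val; apply: eq_bigr => i _; rewrite mxE.
Qed.

Lemma eq_mxf A B : (forall u v, A u v = B u v) -> mxf A = mxf B.
Proof. by move=> e; apply/matrixP => i j; rewrite !mxE e. Qed.

Lemma apD A B f u : ap (fun u v => A u v + B u v) f u = ap A f u + ap B f u.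
Proof. by rewrite -big_split; apply: eq_bigr => v _; rewrite mulrDl. Qed.

Lemma apZ c A f u : ap (fun u v => c * A u v) f u = c * ap A f u.
Proof. by rewrite /ap mulr_sumr; apply: eq_bigr => v _; rewrite mulrA. Qed.

Lemma ap_add A f g u : ap A (fun v => f v + g v) u = ap A f u + ap A g u.
Proof. by rewrite -big_split; apply: eq_bigr => v _; rewrite mulrDr. Qed.

Lemma ap_scale A c f u : ap A (fun v => c * f v) u = c * ap A f u.
Proof. by rewrite /ap mulr_sumr; apply: eq_bigr => v _; rewrite mulrCA. Qed.

Lemma eq_ap A f g u : f =1 g -> ap A f u = ap A g u.
Proof. by move=> e; apply: eq_bigr => v _; rewrite e. Qed.

Lemma ap_id f u : ap (fun u v => (u == v)%:R) f u = f u.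
Proof.
rewrite /ap (bigD1 u) //= eqxx mul1r big1 ?addr0 // => v.
by rewrite eq_sym => /negbTE ->; rewrite mul0r.
Qed.

End FunctionMatrices.

(** The columns of [P] are eigenvectors of the product [AB]. The dual family [Q] serves only to show
    that [P] is invertible, so that [\det P] can be cancelled. *)
Lemma det_mxf_eigenbasis (F : fieldType) (V : finType) (A B P Q : V -> V -> F)
    (d e : V -> F) :
  (forall u w, ap A (ap B (P ^~ w)) u = d w * P u w) ->
  (forall u w, ap Q (P ^~ w) u = (u == w)%:R * e w) ->
  (forall w, e w != 0) ->
  \det (mxf A) * \det (mxf B) = \prod_w d w.
Proof.
move=> hA hQ he.
have hP : \det (mxf P) != 0.
  have : \det (mxf Q *m mxf P) = \prod_w e w.
    by rewrite mxf_mul (eq_mxf hQ) det_mxf_diag.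
  rewrite det_mulmx => h; apply/eqP => h0; move: h; rewrite h0 mulr0 => /esym/eqP.
  by rewrite prodf_seq_eq0 => /hasP[w _]; rewrite (negbTE (he w)).
apply: (mulIf hP); rewrite -!det_mulmx -mulmxA !mxf_mul.
rewrite -det_mxf_diag mulrC -det_mulmx mxf_mul; congr (\det _).
apply: eq_mxf => u w; rewrite hA /ap (bigD1 w) //= eqxx mul1r big1 ?addr0.
  by rewrite mulrC.
by move=> v /negbTE ->; rewrite mul0r mulr0.
Qed.

(** * Tensor products over the three coordinates *)

Section Tensor.
Variables (F : comNzRingType) (I1 I2 I3 : finType).
Local Notation V := (I1 * I2 * I3)%type.

Definition kron (A : I1 -> I1 -> F) (B : I2 -> I2 -> F) (C : I3 -> I3 -> F)
  (u v : V) : F := A u.1.1 v.1.1 * B u.1.2 v.1.2 * C u.2 v.2.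

Definition tens (f : I1 -> F) (g : I2 -> F) (h : I3 -> F) (u : V) : F :=
  f u.1.1 * g u.1.2 * h u.2.

Lemma sum_tens f g h :
  \sum_u tens f g h u = (\sum_i f i) * (\sum_i g i) * (\sum_i h i).
Proof.
rewrite big_distrlr /= pair_big big_distrlr /= pair_big.
by apply: eq_bigr => -[[i j] k].
Qed.

Lemma ap_kron A B C f g h u :
  ap (kron A B C) (tens f g h) u = tens (ap A f) (ap B g) (ap C h) u.
Proof.
rewrite /ap /tens -(sum_tens (fun v => A u.1.1 v * f v)
  (fun v => B u.1.2 v * g v) (fun v => C u.2 v * h v)).
by apply: eq_bigr => v _; rewrite /tens /kron; ring.
Qed.

End Tensor.

(** * Orientation of the dashed edges *)

(** This is where even side lengths enter: reversal has no fixed index, and [J] anticommutes with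
    [S]. *)
Lemma odd_rev_ord n (i : 'I_(2 * n)) : odd (rev_ord i) = ~~ odd i.
Proof. by case: i => i hi /=; lia. Qed.

Section Orientation.
Variables m1 m2 m3 : nat.
Hypothesis hm1 : (0 < m1)%N.
Local Notation vertex := (gvertex (2 * m1) (2 * m2) (2 * m3)).
Implicit Types u v : vertex.

Lemma dashedP u v : dashed u v ->
  [/\ v.1.2 = rev_ord u.1.2, v.2 = rev_ord u.2 & dashed v u].
Proof.
rewrite /dashed => /orP[] h; move: (h) => /and4P[_ _ /eqP-> /eqP->];
  by rewrite ?rev_ordK h ?orbT.
Qed.

(** The boustrophedon turns round at every new row and every new layer, so the direction of a row
    depends on two parities. *)
Lemma along1_label u v : along1 u v ->
  (label u < label v)%N = ((u.1.1 < v.1.1)%N == (odd u.1.2 == odd u.2)).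
Proof.
rewrite !labelE; case: u v => [[[p hp] q] r] [[[p' hp'] q'] r'] /=.
rewrite /along1 /consecutive /= => /and3P[+ /eqP <- /eqP <-].
by case: (odd q); case: (odd r) => /=; lia.
Qed.

(** [labelE] writes labels in mixed radix; two of them are compared by their leading digits. *)
Lemma ltn_lex (k A B a b : nat) : (a < k)%N -> (b < k)%N -> A <> B ->
  (A * k + a < B * k + b)%N = (A < B)%N.
Proof. by nia. Qed.

Lemma along2_label u v : along2 u v ->
  (label u < label v)%N = ((u.1.2 < v.1.2)%N == ~~ odd u.2).
Proof.
rewrite !labelE; case: u v => [[p [q hq]] r] [[p' [q' hq']] r'] /=.
rewrite /along2 /consecutive /= => /and3P[/eqP <- h /eqP <-].
rewrite ltnS ltn_lex; do ?by case: ifP => _; apply: ltn_ord.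
all: by case: (odd r) => /=; lia.
Qed.

Lemma along3_label u v : along3 u v ->
  (label u < label v)%N = (u.2 < v.2)%N.
Proof.
rewrite !labelE; case: u v => [[p q] [r hr]] [[p' q'] [r' hr']] /=.
rewrite /along3 /consecutive /= => /and3P[/eqP <- /eqP <- h].
have hA (b : bool) : ((if b then rev_ord q else q) < 2 * m2)%N.
  by case: b; apply: ltn_ord.
have ne (b c : bool) : (r * (2 * m2) + (if b then rev_ord q else q))%N
    <> (r' * (2 * m2) + (if c then rev_ord q else q))%N.
  have ner : r <> r' by lia.
  by move=> e; have := ltn_lex (hA b) (hA c) ner;
    have := ltn_lex (hA c) (hA b) (nesym ner); rewrite e ltnn; lia.
rewrite ltnS ltn_lex; do ?by case: ifP => _; apply: ltn_ord.
  by rewrite ltn_lex //; lia.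
exact: ne.
Qed.

Variable O : rel vertex.
Hypothesis hO : moebius_orientation O.

Lemma orient1 u v : along1 u v ->
  O u v = ((u.1.1 < v.1.1)%N == (odd u.1.2 == odd u.2)).
Proof. by move=> h; case: hO => _ -> *; rewrite ?along1_label // /solid h. Qed.

Lemma orient2 u v : along2 u v -> O u v = ((u.1.2 < v.1.2)%N == ~~ odd u.2).
Proof.
by move=> h; case: hO => _ -> *; rewrite ?along2_label // /solid h orbT.
Qed.

Lemma orient3 u v : along3 u v -> O u v = (u.2 < v.2)%N.
Proof.
by move=> h; case: hO => _ -> *; rewrite ?along3_label // /solid h !orbT.
Qed.

Lemma orient_dashedC u v : dashed u v -> O v u = ~~ O u v.
Proof.
case: hO => [[_ h]] _ _ _ hd; have : O u v (+) O v u.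
  by apply: h; rewrite /moebius hd orbT.
by case: (O u v); case: (O v u).
Qed.

(* The clockwise-odd squares propagate the direction of the dashed edge at the
   vertex labelled 1 to all other dashed edges. *)
Lemma orient_dashed_from u v : dashed_from u v -> O u v = ~~ odd u.1.2.
Proof.
have h0 : (0 < 2 * m1)%N by lia.
have h1 : ((2 * m1).-1 < 2 * m1)%N by lia.
(* Induction on [q + r] from the corner labelled 1: [r] is lowered while [q] is 0, and [q]
   otherwise. *)
suff key N (q : 'I_(2 * m2)) (r : 'I_(2 * m3)) : (q + r = N)%N ->
    O (Ordinal h0, q, r) (Ordinal h1, rev_ord q, rev_ord r) = ~~ odd q.
  case: u v => [[p q] r] [[p' q'] r'] /and4P[/= hp hp' /eqP -> /eqP ->].
  rewrite -(key _ q r erefl); congr (O (_, _, _) (_, _, _)); exact/val_inj/eqP.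
elim: N q r => [|N IH] q r hqr.
  case: hO => _ _ hone _.
  have [q0 r0] : q = 0%N :> nat /\ r = 0%N :> nat by lia.
  rewrite q0; apply: hone; first by rewrite /dashed /dashed_from /= !eqxx.
  by rewrite labelE /= q0 r0 /= q0.
have hd (s : 'I_(2 * m2)) (t : 'I_(2 * m3)) :
    dashed (Ordinal h0, s, t) (Ordinal h1, rev_ord s, rev_ord t).
  by rewrite /dashed /dashed_from /= !eqxx.
case: hO => _ _ _ hsq; have [q0|q0] := posnP q.
  have [hr hr'] : (r.-1 < 2 * m3)%N /\ (0 < r)%N by have := ltn_ord r; lia.
  pose t := Ordinal hr.
  have hs1 : along3 (Ordinal h0, q, t) (Ordinal h0, q, r).
    by rewrite /along3 /consecutive /= !eqxx /=; lia.
  have hs2 : along3 (Ordinal h1, rev_ord q, rev_ord r)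
                    (Ordinal h1, rev_ord q, rev_ord t).
    rewrite /along3 /consecutive /= !eqxx /=; have := ltn_ord r; lia.
  have [_ _ hd'] := dashedP (hd q t).
  have := hsq _ _ _ _ (_ : solid _ _) (hd q r) (_ : solid _ _) hd'.
  rewrite /solid hs1 hs2 !orbT => /(_ isT isT) /andP[+ _].
  (* Both solid edges follow the traversal, so oddness makes the two dashed edges agree, seen from
     the first face. *)
  rewrite (orient3 hs1) (orient3 hs2) (orient_dashedC (hd q t)) /=.
  have -> : (r.-1 < r)%N by lia.
  have -> : (2 * m3 - r.+1 < 2 * m3 - r.-1.+1)%N by have := ltn_ord r; lia.
  rewrite (IH q t) /=; last by rewrite /=; lia.
  by case: (odd q); case: (O _ _).
have hq : (q.-1 < 2 * m2)%N by have := ltn_ord q; lia.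
pose s := Ordinal hq.
have hs1 : along2 (Ordinal h0, s, r) (Ordinal h0, q, r).
  by rewrite /along2 /consecutive /= !eqxx /=; lia.
have hs2 : along2 (Ordinal h1, rev_ord q, rev_ord r)
                  (Ordinal h1, rev_ord s, rev_ord r).
  rewrite /along2 /consecutive /= !eqxx /=; have := ltn_ord q; lia.
have [_ _ hd'] := dashedP (hd s r).
have := hsq _ _ _ _ (_ : solid _ _) (hd q r) (_ : solid _ _) hd'.
rewrite /solid hs1 hs2 !orbT => /(_ isT isT) /andP[+ _].
(* Reversal flips the parity of [r], so exactly one solid edge follows the traversal, and the dashed
   edges alternate with [q]. *)
rewrite (orient2 hs1) (orient2 hs2) (orient_dashedC (hd s r)) odd_rev_ord /=.
have -> : (q.-1 < q)%N by lia.
have -> : (2 * m2 - q.+1 < 2 * m2 - q.-1.+1)%N by have := ltn_ord q; lia.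
rewrite (IH s r) /=; last by rewrite /=; lia.
have -> : odd q = ~~ odd q.-1 by lia.
by case: (odd r); case: (odd q.-1); case: (O _ _).
Qed.

Lemma orient_dashed u v : dashed u v -> O u v = ~~ odd u.1.2.
Proof.
move=> h; case/orP: (h) => h'; first exact: orient_dashed_from.
have [e _ hd] := dashedP h.
by rewrite (orient_dashedC hd) (orient_dashed_from h') e odd_rev_ord negbK.
Qed.

(** A solid edge changes the parity of one index and a dashed edge that of all three: an odd number
    either way. *)
Lemma moebius_bipartite u v : moebius u v ->
  odd (u.1.1 + u.1.2 + u.2) != odd (v.1.1 + v.1.2 + v.2).
Proof.
rewrite /moebius /solid => /orP[/or3P[] /and3P[]|h].
- by rewrite /consecutive => h /eqP <- /eqP <-; lia.
- by rewrite /consecutive => /eqP <- h /eqP <-; lia.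
- by rewrite /consecutive => /eqP <- /eqP <- h; lia.
have [-> -> _] := dashedP h.
rewrite !oddD !odd_rev_ord.
have : odd u.1.1 != odd v.1.1.
  by case/orP: h => /and4P[/eqP -> /eqP -> _ _]; lia.
by case: (odd u.1.1); case: (odd v.1.1); case: (odd u.1.2); case: (odd u.2).
Qed.

(** * The signed adjacency matrix in tensor form *)

Section SignedAdjacency.
Variable F : comNzRingType.

Definition path_op n (i j : 'I_n) : F :=
  (j == i.+1 :> nat)%:R - (i == j.+1 :> nat)%:R.
Definition sign_op n (i j : 'I_n) : F := (-1) ^+ i * (i == j)%:R.
Definition rev_op n (i j : 'I_n) : F := (rev_ord i == j)%:R.
Definition signrev_op n (i j : 'I_n) : F := (-1) ^+ i * (rev_ord i == j)%:R.
Definition corner_op n (i j : 'I_n) : F :=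
  ((i == 0 :> nat) && (j == n.-1 :> nat))%:R
  + ((j == 0 :> nat) && (i == n.-1 :> nat))%:R.
Definition id_op n (i j : 'I_n) : F := (i == j)%:R.
Arguments path_op {n}.
Arguments sign_op {n}.
Arguments rev_op {n}.
Arguments signrev_op {n}.
Arguments corner_op {n}.
Arguments id_op {n}.

(** Each [sign_op] records a turn of the labelling: first-direction edges turn with both other
    coordinates, second-direction edges with the third only. Dashed edges alternate with the second
    coordinate alone, hence a single sign in their term. *)
Definition skew_op (a1 a2 a3 : F) u v : F :=
  a1 * (kron path_op sign_op sign_op u v + kron corner_op signrev_op rev_op u v)
  + (a2 * kron id_op path_op sign_op u v + a3 * kron id_op id_op path_op u v).

Lemma kron_along1 u v :
  kron path_op sign_op sign_op u v = if along1 u v then sgn F O u v else 0.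
Proof.
case: ifP => [h|].
  rewrite /sgn (orient1 h); case/and3P: h => h /eqP e2 /eqP e3.
  rewrite /kron /path_op /sign_op -e2 -e3 !eqxx !mulr1 -(signr_odd _ u.1.2).
  rewrite -(signr_odd _ u.2).
  have [lt|gt] : (u.1.1.+1 == v.1.1) \/ (v.1.1.+1 == u.1.1) by apply/orP.
    rewrite -(eqP lt) eqxx ltnSn (_ : (nat_of_ord _ == _.+2) = false);
      last by rewrite ltn_eqF.
    by case: (odd _); case: (odd _); rewrite /= ?expr1 ?expr0; ring.
  rewrite -(eqP gt) eqxx (_ : (nat_of_ord _ == _.+2) = false); last by rewrite ltn_eqF.
  rewrite (_ : (_ < _)%N = false); last by rewrite ltnNge leqnSn.
  by case: (odd _); case: (odd _); rewrite /= ?expr1 ?expr0; ring.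
move/negbT; rewrite /kron /path_op /sign_op /along1 !negb_and /consecutive.
case/or3P => [|/negbTE ->|/negbTE ->]; do ?by rewrite !(mulr0, mul0r).
rewrite negb_or ![_ == nat_of_ord _]eq_sym => /andP[/negbTE -> /negbTE].
by rewrite eq_sym => ->; rewrite subrr !mul0r.
Qed.

Lemma kron_along2 u v :
  kron id_op path_op sign_op u v = if along2 u v then sgn F O u v else 0.
Proof.
case: ifP => [h|].
  rewrite /sgn (orient2 h); case/and3P: h => /eqP e2 h /eqP e3.
  rewrite /kron /path_op /sign_op /id_op -e2 -e3 !eqxx mulr1 mul1r.
  rewrite -(signr_odd _ u.2).
  have [lt|gt] : (u.1.2.+1 == v.1.2) \/ (v.1.2.+1 == u.1.2) by apply/orP.
    rewrite -(eqP lt) eqxx ltnSn (_ : (nat_of_ord _ == _.+2) = false);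
      last by rewrite ltn_eqF.
    by case: (odd _); rewrite /= ?expr1 ?expr0; ring.
  rewrite -(eqP gt) eqxx (_ : (nat_of_ord _ == _.+2) = false); last by rewrite ltn_eqF.
  rewrite (_ : (_ < _)%N = false); last by rewrite ltnNge leqnSn.
  by case: (odd _); rewrite /= ?expr1 ?expr0; ring.
move/negbT; rewrite /kron /path_op /sign_op /id_op /along2 !negb_and /consecutive.
case/or3P => [/negbTE ->||/negbTE ->]; [|clear|]; do ?by rewrite !(mulr0, mul0r).
rewrite negb_or ![_ == nat_of_ord _]eq_sym => /andP[/negbTE -> /negbTE].
by rewrite eq_sym => ->; rewrite subrr !(mulr0, mul0r).
Qed.

Lemma kron_along3 u v :
  kron id_op id_op path_op u v = if along3 u v then sgn F O u v else 0.
Proof.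
case: ifP => [h|].
  rewrite /sgn (orient3 h); case/and3P: h => /eqP e2 /eqP e3 h.
  rewrite /kron /path_op /id_op -e2 -e3 !eqxx !mul1r.
  have [lt|gt] : (u.2.+1 == v.2) \/ (v.2.+1 == u.2) by apply/orP.
    rewrite -(eqP lt) eqxx ltnSn (_ : (nat_of_ord _ == _.+2) = false);
      last by rewrite ltn_eqF.
    by rewrite /=; ring.
  rewrite -(eqP gt) eqxx (_ : (nat_of_ord _ == _.+2) = false); last by rewrite ltn_eqF.
  rewrite (_ : (_ < _)%N = false); last by rewrite ltnNge leqnSn.
  by rewrite /=; ring.
move/negbT; rewrite /kron /path_op /id_op /along3 !negb_and /consecutive.
case/or3P => [/negbTE ->|/negbTE ->|]; do ?by rewrite !(mulr0, mul0r).
rewrite negb_or ![_ == nat_of_ord _]eq_sym => /andP[/negbTE -> /negbTE].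
by rewrite eq_sym => ->; rewrite subrr !(mulr0, mul0r).
Qed.

Lemma kron_dashed u v :
  kron corner_op signrev_op rev_op u v = if dashed u v then sgn F O u v else 0.
Proof.
case: ifP => [h|].
  rewrite /sgn (orient_dashed h); have [e2 e3 _] := dashedP h.
  rewrite /kron /corner_op /signrev_op /rev_op e2 e3 !eqxx !mulr1 -signr_odd.
  case/orP: h => /and4P[/eqP -> /eqP -> _ _]; rewrite !eqxx /=.
    rewrite (_ : (_ == 0)%N = false); last by lia.
    by case: (odd _); rewrite /= ?expr1 ?expr0; ring.
  rewrite (_ : (_ == 0)%N = false) /=; last by lia.
  by case: (odd _); rewrite /= ?expr1 ?expr0; ring.
rewrite /kron /corner_op /signrev_op /rev_op /dashed /dashed_from.
rewrite -(can2_eq rev_ordK rev_ordK u.1.2) -(can2_eq rev_ordK rev_ordK u.2).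
rewrite (eq_sym v.1.2) (eq_sym v.2).
have [e2|] := eqVneq (rev_ord u.1.2) v.1.2; last by rewrite !(mulr0, mul0r).
have [e3|] := eqVneq (rev_ord u.2) v.2; last by rewrite !(mulr0, mul0r).
rewrite /= !andbT; case/norP => /negbTE -> /negbTE ->.
by rewrite addr0 !mul0r.
Qed.

Lemma signed_adjacencyE (x a1 a2 a3 : F) u v :
  signed_adjacency (@moebius _ _ _) O (fun _ => x) (moebius_weight a1 a2 a3) u v
  = x * (u == v)%:R + skew_op a1 a2 a3 u v.
Proof.
rewrite /skew_op kron_along1 kron_along2 kron_along3 kron_dashed.
rewrite /signed_adjacency /moebius_weight /moebius /solid.
have [hd|hd] := boolP (dashed u v).
  have [e2 e3 _] := dashedP hd.
  have o2 := odd_rev_ord u.1.2; have o3 := odd_rev_ord u.2.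
  rewrite -e2 in o2; rewrite -e3 in o3.
  (* The ends of a dashed edge differ in both other coordinates, so it is never also solid, even
     when [m1 = 1] makes the first coordinates consecutive. *)
  have n2 : u.1.2 == v.1.2 = false.
    by apply/negP => /eqP e; move: o2; rewrite e; case: (odd _).
  have n3 : u.2 == v.2 = false.
    by apply/negP => /eqP e; move: o3; rewrite e; case: (odd _).
  rewrite /along1 /along2 /along3 n2 n3 !(andbF, orbT) /=.
  rewrite (_ : u == v = false); last by apply/negP => /eqP e; rewrite e eqxx in n2.
  by rewrite ?(mulr0n, mulr1n) /= ?(mulr0n, mulr1n); ring.
rewrite !orbF.
have [->|ne] := eqVneq u v.
  by rewrite /along1 /along2 /along3 /consecutive !(gtn_eqF, eqxx) //=
    ?(mulr0n, mulr1n); ring.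
have [h1|h1] := boolP (along1 u v).
  have -> : along2 u v = false.
    by apply/negP; move: h1 => /and3P[h _ _] /and3P[/eqP e _ _];
    move: h; rewrite e /consecutive; lia.
  have -> : along3 u v = false.
    by apply/negP; move: h1 => /and3P[h _ _] /and3P[/eqP e _ _];
    move: h; rewrite e /consecutive; lia.
  by rewrite /= ?(mulr0n, mulr1n); ring.
have [h2|h2] := boolP (along2 u v).
  have -> : along3 u v = false.
    by apply/negP; move: h2 => /and3P[_ h _] /and3P[_ /eqP e _];
    move: h; rewrite e /consecutive; lia.
  by rewrite /= ?(mulr0n, mulr1n); ring.
by case: (along3 u v) => /=; rewrite ?(mulr0n, mulr1n); ring.
Qed.

End SignedAdjacency.
End Orientation.

(** * Eigenvectors *)

Section Operators.
Variable F : comNzRingType.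
Local Notation T := (@path_op F _).
Local Notation S := (@sign_op F _).
Local Notation J := (@rev_op F _).
Local Notation SJ := (@signrev_op F _).
Local Notation E := (@corner_op F _).
Local Notation I := (@id_op F _).

Lemma sum_ord_delta n (H : nat -> F) (m : nat) :
  \sum_(j < n) (j == m :> nat)%:R * H j = (m < n)%N%:R * H m.
Proof.
have [lt|le] := ltnP m n.
  rewrite (bigD1 (Ordinal lt)) //= eqxx mul1r big1 ?addr0 ?mul1r // => j.
  by rewrite -val_eqE /= => /negbTE ->; rewrite mul0r.
rewrite mul0r big1 // => j _; rewrite (_ : (_ == _) = false) ?mul0r //.
by apply: ltn_eqF; apply: leq_trans le.
Qed.

Variable n : nat.
Implicit Types (g : 'I_n -> F) (i : 'I_n).

Lemma ap_sign g i : ap S g i = (-1) ^+ i * g i.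
Proof.
rewrite -[in RHS](ap_id g i) /ap mulr_sumr.
by apply: eq_bigr => j _; rewrite mulrA.
Qed.

Lemma ap_rev g i : ap J g i = g (rev_ord i).
Proof. by rewrite -[RHS]ap_id. Qed.

Lemma ap_signrev g i : ap SJ g i = (-1) ^+ i * g (rev_ord i).
Proof.
rewrite -[in RHS](ap_id g (rev_ord i)) /ap mulr_sumr.
by apply: eq_bigr => j _; rewrite mulrA.
Qed.

Lemma ap_path (G : nat -> F) i :
  ap T (fun j => G j.+1) i
  = (i.+1 < n)%N%:R * G i.+2 - (0 < i)%N%:R * G i.
Proof.
rewrite /ap /path_op; under eq_bigr do rewrite mulrBl.
rewrite sumrB (sum_ord_delta n (fun j => G j.+1)); congr (_ - _).
case: i => -[|i] hi /=; first by rewrite big1 ?mul0r // => j _; rewrite mul0r.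
have := sum_ord_delta n (fun j => G j.+1) i; rewrite (ltnW hi) /= => <-.
by apply: eq_bigr => j _; rewrite eqSS eq_sym.
Qed.

Lemma ap_corner (G : nat -> F) i :
  ap E (fun j => G j) i = (i == 0 :> nat)%:R * G n.-1 + (i.+1 == n)%:R * G 0.
Proof.
have n0 : (0 < n)%N by apply: leq_ltn_trans (ltn_ord i).
rewrite /ap /corner_op; under eq_bigr do rewrite mulrDl -!mulnb !natrM -!mulrA.
rewrite big_split /= -mulr_sumr (sum_ord_delta n G n.-1).
rewrite (_ : (n.-1 < n)%N) ?mul1r; last by lia.
congr (_ + _); under eq_bigr do rewrite mulrCA.
rewrite -mulr_sumr (sum_ord_delta n G 0) n0 mul1r.
by congr (_%:R * _); congr nat_of_bool; apply/eqP/eqP; lia.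
Qed.

Lemma ap_signK g i : ap S (ap S g) i = g i.
Proof. by rewrite !ap_sign mulrA -expr2 -exprM mulnC exprM sqrrN !expr1n mul1r. Qed.

(** [T] moves by one index, across which [S] changes sign. *)
Lemma ap_path_sign g i : ap T (ap S g) i = - ap S (ap T g) i.
Proof.
rewrite (eq_ap _ _ (ap_sign g)) ap_sign /ap mulr_sumr -sumrN.
apply: eq_bigr => j _; rewrite /path_op.
have [->|_] := eqVneq (nat_of_ord j) i.+1.
  by rewrite exprS; ring.
have [->|_] := eqVneq (nat_of_ord i) j.+1.
  by rewrite exprS; ring.
by rewrite subrr; ring.
Qed.

(** Reversal exchanges the forward and backward entries of [T], which have opposite signs. *)
Lemma ap_rev_path g i : ap J (ap T g) i = - ap T (ap J g) i.
Proof.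
rewrite (eq_ap _ _ (ap_rev g)) ap_rev /ap (reindex_inj rev_ord_inj) /= -sumrN.
apply: eq_bigr => j _; rewrite /path_op /=.
have hi := ltn_ord i; have hj := ltn_ord j.
rewrite (_ : (n - j.+1 == (n - i.+1).+1) = (nat_of_ord i == j.+1))%N; last by lia.
rewrite (_ : (n - i.+1 == (n - j.+1).+1) = (nat_of_ord j == i.+1))%N; last by lia.
by ring.
Qed.

End Operators.

Lemma ap_rev_sign (F : comNzRingType) m (g : 'I_(2 * m) -> F) i :
  ap (@rev_op F _) (ap (@sign_op F _) g) i
  = - ap (@sign_op F _) (ap (@rev_op F _) g) i.
Proof.
rewrite ap_rev !ap_sign ap_rev -(signr_odd _ (rev_ord i)) odd_rev_ord.
by rewrite -(signr_odd _ i) signrN mulNr.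
Qed.

(** * The skew part and its square on tensors *)

Section SkewEigen.
Variables (F : comNzRingType) (m1 m2 m3 : nat) (a1 a2 a3 : F).
Local Notation T := (@path_op F _).
Local Notation S := (@sign_op F _).
Local Notation J := (@rev_op F _).
Local Notation E := (@corner_op F _).
Local Notation skew := (@skew_op m1 m2 m3 F a1 a2 a3).

(** Each tensor has exactly one antisymmetric factor: a [T], or in the dashed term [SJ], which is
    antisymmetric because the side is even. *)
Lemma skew_op_antisym u v : skew v u = - skew u v.
Proof.
have Ta n (i j : 'I_n) : T j i = - T i j by rewrite /path_op; ring.
have Ss n (i j : 'I_n) : S j i = S i j.
  by rewrite /sign_op eq_sym; case: eqP => [->|]; rewrite ?mulr0.
have Is n (i j : 'I_n) : @id_op F _ j i = id_op F i j.
  by rewrite /id_op eq_sym.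
have Js n (i j : 'I_n) : J j i = J i j.
  by rewrite /rev_op (can2_eq rev_ordK rev_ordK) eq_sym.
have Es n (i j : 'I_n) : E j i = E i j by rewrite /corner_op addrC.
have SJa m (i j : 'I_(2 * m)) :
    @signrev_op F _ j i = - signrev_op F i j.
  rewrite /signrev_op (can2_eq rev_ordK rev_ordK) eq_sym.
  case: eqP => [<-|]; rewrite ?mulr0 ?oppr0 //.
  by rewrite -signr_odd odd_rev_ord signrN signr_odd mulNr.
rewrite /skew_op /kron !(Ta _ u.1.1) !(Ta _ u.1.2) !(Ta _ u.2) !(Ss _ u.1.2).
rewrite !(Ss _ u.2) !(Is _ u.1.1) !(Is _ u.1.2) !(Js _ u.2) !(Es _ u.1.1).
by rewrite !(SJa _ u.1.2); ring.
Qed.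

(** On such [g] and [h] the factors [SJ] and [J] of the dashed term act as [d S] and [eta S]. It
    then has the shape of the first path term, and the two merge into [T + d eta E] on [f]. *)
Lemma skew_tens f g h d eta mu l u :
  (forall i, g (rev_ord i) = d * g i) ->
  (forall i, h (rev_ord i) = eta * ((-1) ^+ i * h i)) ->
  (forall i, ap T h i = l * h i) ->
  (forall i, ap T f i + d * eta * ap E f i = mu * f i) ->
  ap skew (tens f g h) u =
    a1 * mu * tens f (ap S g) (ap S h) u
    + a2 * tens f (ap T g) (ap S h) u + a3 * l * tens f g h u.
Proof.
move=> hg hh hT hf.
rewrite apD apZ !apD !apZ !ap_kron /tens !ap_sign ap_signrev ap_rev !ap_id hg hh hT.
have -> : ap T f u.1.1 = mu * f u.1.1 - d * eta * ap E f u.1.1.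
  by rewrite -hf addrK.
by ring.
Qed.

(** The tensors produced by [skew_tens] satisfy its hypotheses again: [d] and [eta] change sign only
    together, so the twist [d eta] and the eigenvalue [mu] persist. The cross terms cancel by
    anticommutation. *)
Lemma skew_sq_tens f g h d eta mu l2 l u :
  (forall i, g (rev_ord i) = d * g i) ->
  (forall i, h (rev_ord i) = eta * ((-1) ^+ i * h i)) ->
  (forall i, ap T (ap T g) i = l2 * g i) ->
  (forall i, ap T h i = l * h i) ->
  (forall i, ap T f i + d * eta * ap E f i = mu * f i) ->
  ap skew (ap skew (tens f g h)) u =
    (a1 ^+ 2 * mu ^+ 2 + a2 ^+ 2 * l2 + a3 ^+ 2 * l ^+ 2) * tens f g h u.
Proof.
move=> hg hh hTg hTh hf.
have hSh i : ap S h (rev_ord i) = - eta * ((-1) ^+ i * ap S h i).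
  have := ap_rev_sign h i; rewrite ap_rev => ->.
  by rewrite !ap_sign ap_rev hh; ring.
have hTSh i : ap T (ap S h) i = - l * ap S h i.
  by rewrite ap_path_sign !ap_sign hTh; ring.
have hSg i : ap S g (rev_ord i) = - d * ap S g i.
  have := ap_rev_sign g i; rewrite ap_rev => ->.
  by rewrite !ap_sign ap_rev hg; ring.
have hTg' i : ap T g (rev_ord i) = - d * ap T g i.
  have := ap_rev_path g i; rewrite ap_rev => ->.
  by rewrite (eq_ap _ _ (ap_rev g)) (eq_ap _ _ hg) ap_scale mulNr.
have hf' i : ap T f i + - d * - eta * ap E f i = mu * f i by rewrite mulrNN.
rewrite (eq_ap _ _ (fun v => skew_tens v hg hh hTh hf)) !ap_add !ap_scale.
rewrite (skew_tens _ hSg hSh hTSh hf') (skew_tens _ hTg' hSh hTSh hf').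
rewrite (skew_tens _ hg hh hTh hf) /tens !ap_signK ap_path_sign hTg.
by ring.
Qed.

End SkewEigen.

Section Eigenvectors.
Variable R : realType.
Local Notation C := R[i].
Local Notation T := (@path_op C _).
Local Notation E := (@corner_op C _).

Definition cis (t : R) : C := (cos t +i* sin t)%C.

Lemma cisD s t : cis (s + t) = cis s * cis t.
Proof. by rewrite /cis cosD sinD; simpc; congr (_ +i* _)%C; ring. Qed.

Lemma cis0 : cis 0 = 1.
Proof. by rewrite /cis cos0 sin0. Qed.

Lemma cisX t n : cis t ^+ n = cis (n%:R * t).
Proof.
elim: n => [|n IH]; first by rewrite mul0r cis0.
by rewrite exprS IH -cisD; congr cis; rewrite -natr1; ring.
Qed.

Lemma cis_neq0 t : cis t != 0.
Proof.
apply/eqP => h; have := cis0; rewrite -(subrr t) cisD h mul0r => /eqP.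
by rewrite eq_sym oner_eq0.
Qed.

Lemma cis_subN t : (cis t - cis (- t)) ^+ 2 = (- 4 * sin t ^+ 2)%:C%C.
Proof.
by rewrite /cis cosN sinN expr2; simpc; congr (_ +i* _)%C; ring.
Qed.

Lemma cis_period t n : cis (t + n%:R * (2 * pi)) = cis t.
Proof.
elim: n t => [|n IH] t; first by rewrite mul0r addr0.
rewrite -natr1 mulrDl mul1r addrA addrAC IH /cis.
by rewrite [_ *pi]mulr_natl cosD2pi sinD2pi.
Qed.

(* [z ^ p] is an eigenvector of [T + w E] as soon as [z ^ n = w]; the
   condition [w ^ 2 = -1] makes both ends of the path agree. *)
Lemma ap_path_twist n (z w : C) (i : 'I_n) : z != 0 -> w ^+ 2 = -1 ->
  z ^+ n = w ->
  ap T (fun j : 'I_n => z ^+ j) i + w * ap E (fun j : 'I_n => z ^+ j) i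
  = (z - z^-1) * z ^+ i.
Proof.
move=> z0 w2 zn.
have -> : ap T (fun j : 'I_n => z ^+ j) i
    = (i.+1 < n)%N%:R * (z^-1 * z ^+ i.+2) - (0 < i)%N%:R * (z^-1 * z ^+ i).
  rewrite -(ap_path (fun m => z^-1 * z ^+ m)).
  by apply: eq_ap => j; rewrite exprS mulKf.
rewrite (ap_corner (fun m => z ^+ m)).
have hi := ltn_ord i.
have ww : w * w = -1 by rewrite -expr2.
have -> : (0 < i)%N%:R = 1 - (i == 0 :> nat)%:R :> C.
  by case: (nat_of_ord i) => [|k] /=; rewrite ?subr0 ?subrr.
have -> : (i.+1 < n)%N%:R = 1 - (i.+1 == n)%:R :> C.
  rewrite ltn_neqAle hi andbT; case: eqP => _ /=; rewrite ?subr0 ?subrr //.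
have -> : z ^+ n.-1 = z^-1 * w.
  by rewrite -zn -[in RHS](prednK (leq_ltn_trans (leq0n i) hi)) exprS mulKf.
have -> : z^-1 * z ^+ i.+2 = z * z ^+ i by rewrite !exprS mulKf.
have [ei|_] := eqVneq i.+1 n; have [ei'|_] := eqVneq (nat_of_ord i) 0%N.
- rewrite ei' !expr0 /=.
  have n1 : n = 1%N by rewrite -ei ei'.
  have -> : z = w by rewrite -zn n1.
  have -> : w^-1 = - w.
    apply: (mulfI (_ : w != 0)).
      by apply/eqP => h; move/eqP: ww; rewrite h mul0r eq_sym oppr_eq0 oner_eq0.
    rewrite mulfV ?mulrN ?ww ?opprK //.
    by apply/eqP => h; move/eqP: ww; rewrite h mul0r eq_sym oppr_eq0 oner_eq0.
  by rewrite ?(mulr0n, mulr1n, expr0) /= (mulNr w w) ww; ring.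
- have -> : w = z * z ^+ i by rewrite -exprS ei zn.
  by rewrite ?(mulr0n, mulr1n, expr0) /=; ring.
- rewrite ei' /= expr0.
  rewrite ?(mulr0n, mulr1n, expr0) (_ : w * _ = w * w * z^-1); last by ring.
  by rewrite ww; ring.
- by rewrite ?(mulr0n, mulr1n, expr0) /=; ring.
Qed.

(** * Sine eigenvectors of the signed path *)

Section SineBasis.
Variable n : nat.
Definition sine_angle (k : nat) : R := k.+1%:R * pi / n.+1%:R.

(** The powers of [i] conjugate the antisymmetric path matrix into [i] times the symmetric one,
    whose eigenvectors are the sines. *)
Definition sine_vec (k : 'I_n) (p : 'I_n) : C :=
  'i%C ^+ p.+1 * (sin (p.+1%:R * sine_angle k))%:C%C.

Definition sine_covec (k : 'I_n) (p : 'I_n) : C :=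
  (- 'i%C) ^+ p.+1 * (sin (p.+1%:R * sine_angle k))%:C%C.

Lemma sine_angle_full k : n.+1%:R * sine_angle k = k.+1%:R * pi.
Proof. by rewrite /sine_angle mulrC divfK // pnatr_eq0. Qed.

Lemma sin_nat_pi (k : nat) : sin (k%:R * pi) = 0 :> R.
Proof.
elim: k => [|k IH]; first by rewrite mul0r sin0.
by rewrite -natr1 mulrDl mul1r sinDpi IH oppr0.
Qed.

Lemma cos_nat_pi (k : nat) : cos (k%:R * pi) = (-1) ^+ k :> R.
Proof.
elim: k => [|k IH]; first by rewrite mul0r cos0.
by rewrite -natr1 mulrDl mul1r cosDpi IH exprS mulN1r.
Qed.

Lemma sqr_imag : ('i%C : C) ^+ 2 = -1.
Proof. exact: sqr_i. Qed.

Lemma sine_vec_path k i :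
  ap T (sine_vec k) i = (2 * 'i%C * (cos (sine_angle k))%:C%C) * sine_vec k i.
Proof.
set al := sine_angle k.
have -> : ap T (sine_vec k) i = _ :=
  ap_path (fun p => 'i%C ^+ p * (sin (p%:R * al))%:C%C) i.
have -> : (i.+1 < n)%N%:R * ('i%C ^+ i.+2 * (sin (i.+2%:R * al))%:C%C)
    = 'i%C ^+ i.+2 * (sin (i.+2%:R * al))%:C%C.
  have [lt|] := ltnP i.+1 n; first by rewrite mul1r.
  have hi := ltn_ord i.
  move=> le; have -> : i.+2 = n.+1 by lia.
  by rewrite sine_angle_full sin_nat_pi !mulr0.
have -> : (0 < i)%N%:R * ('i%C ^+ i * (sin (i%:R * al))%:C%C)
    = 'i%C ^+ i * (sin (i%:R * al))%:C%C.
  by case: (nat_of_ord i) => [|m] /=; rewrite ?mul1r // !mul0r sin0 ?mulr0.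
rewrite /sine_vec -/al.
have -> : i.+2%:R * al = i.+1%:R * al + al by rewrite -natr1; ring.
have -> : i%:R * al = i.+1%:R * al - al by rewrite -natr1; ring.
rewrite sinD sinB !exprS mulrA -expr2 sqr_imag !rmorphD /= rmorphN !rmorphM /=.
have := sqr_imag; set I := 'i%C => hI.
rewrite (_ : 2 * I * _ * _ = 2 * (I ^+ 2) * I ^+ i * (cos al)%:C%C
  * (sin (i.+1%:R * al))%:C%C); last by ring.
by rewrite hI; ring.
Qed.

(** [T] commutes with [SJ], so its sine eigenvectors are eigenvectors of [SJ] too; the factor before
    the alternating sign is their eigenvalue. *)
Lemma sine_vec_rev k i :
  sine_vec k (rev_ord i)
  = (-1) ^+ k * 'i%C ^+ n * - 'i%C * ((-1) ^+ i * sine_vec k i).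
Proof.
rewrite /sine_vec /=; set al := sine_angle k.
have hi := ltn_ord i.
have e1 : (n - i.+1).+1%:R * al = k.+1%:R * pi - i.+1%:R * al.
  rewrite -(sine_angle_full k) -mulrBl -natrB; last by lia.
  by congr (_%:R * _); lia.
rewrite e1 sinB sin_nat_pi cos_nat_pi mul0r sub0r (exprS (-1)) mulN1r mulNr opprK.
have e2 : ('i%C : C) ^+ (n - i.+1).+1 = 'i%C ^+ n * (-1) ^+ i * 'i%C ^+ i.
  have h : 'i%C ^+ i * (-1) ^+ i * 'i%C ^+ i = 1 :> C.
    rewrite -sqr_imag -exprM -!exprD.
    rewrite (_ : (i + 2 * i + i = 2 * 2 * i)%N); last by lia.
    by rewrite !exprM sqr_imag sqrrN !expr1n.
  have -> : ('i%C : C) ^+ n = 'i%C ^+ (n - i.+1).+1 * 'i%C ^+ i.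
    by rewrite -exprD; congr (_ ^+ _); lia.
  by rewrite -!mulrA (mulrA ('i%C ^+ i)) h mulr1.
rewrite e2 rmorphM rmorphXn rmorphN1 exprS /=.
have := sqr_imag; set I := 'i%C => hI.
rewrite (_ : _ * - I * _ = - (I ^+ 2) * ((-1) ^+ k * I ^+ n * (-1) ^+ i
  * I ^+ i * (sin (i.+1%:R * al))%:C%C)); last by ring.
by rewrite hI; ring.
Qed.

End SineBasis.
End Eigenvectors.

(** * Orthogonality *)

Section Orthogonality.
Variable R : realType.
Local Notation C := R[i].

Lemma sin_ratio_gt0 (a b : nat) : (0 < a < b)%N -> 0 < sin (a%:R * pi / b%:R) :> R.
Proof.
move=> /andP[a0 ab]; have b0 : 0 < b%:R :> R by rewrite ltr0n; lia.
apply: sin_gt0_pi; apply/andP; split.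
  by rewrite divr_gt0 // mulr_gt0 ?pi_gt0 ?ltr0n.
by rewrite ltr_pdivrMr // mulrC ltr_pM2l ?pi_gt0 // ltr_nat.
Qed.

Lemma sum_cos n (m : nat) : (0 < m < 2 * n.+1)%N ->
  \sum_(p < n) cos (p.+1%:R * (m%:R * pi / n.+1%:R)) = - (1 + (-1) ^+ m) / 2 :> R.
Proof.
move=> /andP[m0 mn]; set th := m%:R * pi / n.+1%:R : R.
have n0 : n.+1%:R != 0 :> R by rewrite pnatr_eq0.
have n0' : 1 + n%:R != 0 :> R by rewrite nat1r.
have s0 : 0 < sin (th / 2).
  have -> : th / 2 = m%:R * pi / (2 * n.+1)%N%:R by rewrite /th natrM; field.
  by apply: sin_ratio_gt0; rewrite m0.
(* Each product [2 sin (th / 2) cos (p th)] is the difference of the sines of [p th + th / 2] and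
   [p th - th / 2], so the sum telescopes. *)
have tele N : 2 * sin (th / 2) * (\sum_(p < N) cos (p.+1%:R * th))
    = sin (N%:R * th + th / 2) - sin (th / 2).
  elim: N => [|N IH]; first by rewrite big_ord0 mulr0 mul0r add0r subrr.
  rewrite big_ord_recr mulrDr IH /=.
  have -> : N%:R * th + th / 2 = N.+1%:R * th - th / 2.
    by rewrite -natr1; field.
  by rewrite sinB sinD; ring.
have := tele n.
have -> : n%:R * th + th / 2 = m%:R * pi - th / 2.
  have : n.+1%:R * th = m%:R * pi by rewrite /th mulrC divfK.
  by rewrite -natr1 => <-; field.
rewrite sinB sin_nat_pi cos_nat_pi mul0r sub0r => e.
apply: (mulfI (_ : 2 * sin (th / 2) != 0)).
  by rewrite mulf_neq0 ?pnatr_eq0 ?gt_eqF.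
by rewrite e; field.
Qed.

Lemma sum_sin_sin n (k l : 'I_n) :
  \sum_(p < n) sin (p.+1%:R * sine_angle R n k) * sin (p.+1%:R * sine_angle R n l)
  = (k == l)%:R * (n.+1%:R / 2) :> R.
Proof.
wlog le : k l / (l <= k)%N => [hw|].
  have [le|lt] := leqP l k; first exact: hw.
  rewrite eq_sym -hw ?(ltnW lt) //.
  by apply: eq_bigr => p _; rewrite mulrC.
have ang p : sin (p.+1%:R * sine_angle R n k) * sin (p.+1%:R * sine_angle R n l)
   = 2^-1 * cos (p.+1%:R * ((k - l)%N%:R * pi / n.+1%:R))
     - 2^-1 * cos (p.+1%:R * ((k + l + 2)%N%:R * pi / n.+1%:R)).
  rewrite (_ : p.+1%:R * ((k - l)%N%:R * pi / n.+1%:R) =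
    p.+1%:R * sine_angle R n k - p.+1%:R * sine_angle R n l); last first.
    by rewrite /sine_angle natrB // -!natr1; ring.
  rewrite (_ : p.+1%:R * ((k + l + 2)%N%:R * pi / n.+1%:R) =
    p.+1%:R * sine_angle R n k + p.+1%:R * sine_angle R n l); last first.
    by rewrite /sine_angle !natrD -!natr1; ring.
  by rewrite cosB cosD; field.
under eq_bigr do rewrite ang.
have hk := ltn_ord k; have hl := ltn_ord l.
rewrite sumrB -!mulr_sumr (sum_cos (m := k + l + 2)); last by lia.
have [->|ne] := eqVneq k l.
  rewrite subnn; under eq_bigr do rewrite mul0r mul0r mulr0 cos0.
  rewrite sumr_const card_ord -signr_odd (_ : odd _ = false); last by lia.
  by rewrite -natr1 expr0 /= ?mulr1n; field.
have ne' : nat_of_ord k <> l by move=> h; case/eqP: ne; apply: val_inj.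
rewrite (sum_cos (m := k - l)); last by lia.
(* [k - l] and [k + l + 2] have the same parity, so the two cosine sums cancel. *)
rewrite -signr_odd -(signr_odd _ (k + l + 2)).
rewrite (_ : odd (k - l) = odd (k + l + 2)); last by lia.
by rewrite mul0r subrr.
Qed.

Lemma sine_orthogonal n (k l : 'I_n) :
  \sum_p sine_covec R k p * sine_vec R l p = (k == l)%:R * (n.+1%:R / 2).
Proof.
have -> : (k == l)%:R * (n.+1%:R / 2) = ((k == l)%:R * (n.+1%:R / 2) : R)%:C%C :> C.
  by rewrite rmorphM fmorph_div !rmorph_nat.
rewrite -sum_sin_sin rmorph_sum; apply: eq_bigr => p _.
rewrite /sine_covec /sine_vec rmorphM /= mulrACA -exprMn mulNr -expr2 sqr_i opprK.
by rewrite expr1n mul1r.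
Qed.

Lemma cisN t : cis (- t) = (cis t)^-1 :> C.
Proof.
apply: (mulfI (cis_neq0 t)); rewrite mulfV ?cis_neq0 //.
by rewrite -cisD subrr cis0.
Qed.

Lemma cis_pi2 : cis (pi / 2) = 'i%C :> C.
Proof. by rewrite /cis cos_pihalf sin_pihalf. Qed.

(* [b] selects which of the two square roots of -1 the n-th powers equal. *)
Definition twist_angle n (b : bool) (j : nat) : R :=
  (-1) ^+ b * ((4 * j%:R + 3) * pi / (2 * n%:R)).

Definition twist_root n b j : C := cis (twist_angle n b j).

Lemma twist_rootX n b j : (0 < n)%N -> twist_root n b j ^+ n = (-1) ^+ b * - 'i%C.
Proof.
move=> n0; have nn0 : n%:R != 0 :> R by rewrite pnatr_eq0 -lt0n.
have e : twist_root n false j ^+ n = - 'i%C.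
  rewrite /twist_root cisX /twist_angle expr0 mul1r.
  (* The [n]-fold angle is [3 pi / 2] up to full turns. With [i = j + 1] the numerator [4 j + 3] is
     the [4 i - 1] of the final formula. *)
  rewrite (_ : n%:R * _ = 3%:R * (pi / 2) + j%:R * (2 * pi)); last by field.
  by rewrite cis_period -cisX cis_pi2 exprS sqr_i mulrN1.
case: b => //=; last by rewrite expr0 mul1r.
have -> : twist_root n true j = (twist_root n false j)^-1.
  by rewrite /twist_root -cisN /twist_angle expr0 mul1r expr1 mulN1r.
rewrite exprVn e.
have i0 : - 'i%C != 0 :> C.
  by apply/eqP => h; have := sqr_i R; rewrite -sqrrN h expr0n => /eqP;
     rewrite eq_sym oppr_eq0 oner_eq0.
apply: (mulfI i0); rewrite mulfV // expr1 mulN1r opprK mulNr -expr2 sqr_i opprK.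
by [].
Qed.

Lemma twist_root_inj n b (j j' : 'I_n) :
  twist_root n b j = twist_root n b j' -> j = j'.
Proof.
wlog le : j j' / (j <= j')%N => [hw e|].
  have [le|lt] := leqP j j'; first exact: hw.
  by apply/esym/hw; rewrite ?(ltnW lt).
move=> e; apply/val_inj/eqP; rewrite /= eqn_leq le /= leqNgt; apply/negP => lt.
have n0 : (0 < n)%N by apply: leq_ltn_trans (ltn_ord j).
have nn0 : n%:R != 0 :> R by rewrite pnatr_eq0 -lt0n.
(* The two angles differ by [2 t] up to sign, with [0 < t < pi]; equal roots give [cos (2 t) = 1],
   which contradicts [sin t > 0]. *)
set t : R := (j' - j)%N%:R * pi / n%:R.
have c1 : cis (t + t) = 1 :> C.
  have h : cis (twist_angle n b j' - twist_angle n b j) = 1 :> C.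
    by rewrite cisD cisN; move: e; rewrite /twist_root => ->; rewrite mulfV ?cis_neq0.
  have h2 : twist_angle n b j' - twist_angle n b j = (-1) ^+ b * (t + t).
    by rewrite /twist_angle /t natrB //; field.
  move: h; rewrite h2; case: (b) => /=; last by rewrite expr0 mul1r.
  by rewrite expr1 mulN1r cisN => /(congr1 (fun x => x^-1)); rewrite invrK invr1.
have st : 0 < sin t.
  by apply: sin_ratio_gt0; have := ltn_ord j'; lia.
have : cos (t + t) = 1 by have := congr1 (@complex.Re R) c1.
have := cos2Dsin2 t; rewrite cosD.
by move: st; nra.
Qed.

(** A geometric sum whose ratio is an [n]-th root of unity, since all roots for one [b] have the
    same [n]-th power. *)
Lemma twist_orthogonal n b (j j' : 'I_n) :
  \sum_(p < n) (twist_root n b j)^-1 ^+ p * twist_root n b j' ^+ p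
  = (j == j')%:R * n%:R.
Proof.
have n0 : (0 < n)%N by apply: leq_ltn_trans (ltn_ord j).
under eq_bigr do rewrite -exprMn.
set z := _ * _.
have [e|ne] := eqVneq j j'.
  have -> : z = 1 by rewrite /z e mulVf ?cis_neq0.
  under eq_bigr do rewrite expr1n.
  by rewrite sumr_const card_ord mul1r.
have z1 : z - 1 != 0.
  apply: contra ne => /eqP h; apply/eqP/(@twist_root_inj n b).
  have : z = 1 by rewrite -[z](subrK 1) h add0r.
  move=> h'; apply: (mulfI (_ : (twist_root n b j)^-1 != 0)).
    by rewrite invr_eq0 cis_neq0.
  by rewrite mulVf ?cis_neq0 // -h'.
rewrite mul0r; apply: (mulfI z1); rewrite -subrX1 mulr0 /z exprMn exprVn.
by rewrite !twist_rootX // mulVf ?subrr // -(@twist_rootX n b j) // expf_neq0 ?cis_neq0.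
Qed.

End Orthogonality.

(** * The spectrum of the squared skew part *)

Section SkewSpectrum.
Variable R : realType.
Local Notation C := R[i].
Local Notation T := (@path_op C _).
Local Notation S := (@sign_op C _).
Local Notation J := (@rev_op C _).

(** The eigenvalue of [SJ] on the [k]-th sine vector; on a side of even length it is a square root
    of -1. *)
Definition reversal_sign n (k : nat) : C := (-1) ^+ k * 'i%C ^+ n * - 'i%C.

Lemma reversal_sign_sqr m k : reversal_sign (2 * m) k ^+ 2 = -1.
Proof.
by rewrite /reversal_sign (exprM _ 2 m) sqr_i !exprMn !sqrr_sign sqrrN sqr_i !mul1r.
Qed.

(* [I + iS] turns a common eigenvector of [T] and [SJ] into one of [T^2] and
   [J], because [J] anticommutes with [S]. *)
Definition mirror_vec n (k p : 'I_n) : C :=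
  (1 + 'i%C * (-1) ^+ p) * sine_vec R k p.

Definition mirror_covec n (k p : 'I_n) : C :=
  (1 - 'i%C * (-1) ^+ p) * sine_covec R k p.

Lemma mirror_vecE n (k : 'I_n) :
  mirror_vec k =1 (fun p => sine_vec R k p + 'i%C * ap S (sine_vec R k) p).
Proof. by move=> p; rewrite /mirror_vec ap_sign; ring. Qed.

(** For a sign [s] one has [s (1 - i s) = - i (1 + i s)], which absorbs the alternating sign of
    [sine_vec_rev]. *)
Lemma mirror_vec_rev m (k p : 'I_(2 * m)) :
  mirror_vec k (rev_ord p)
  = (- 'i%C * reversal_sign (2 * m) k) * mirror_vec k p.
Proof.
rewrite /mirror_vec sine_vec_rev -/(reversal_sign _ _).
rewrite -signr_odd odd_rev_ord signrN signr_odd.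
have s2 : (-1) ^+ p * (-1) ^+ p = 1 :> C by rewrite -expr2 sqrr_sign.
have i2 : 'i%C * 'i%C = -1 :> C by rewrite -expr2 sqr_i.
transitivity (reversal_sign (2 * m) k * sine_vec R k p
  * ((-1) ^+ p - 'i%C * ((-1) ^+ p * (-1) ^+ p))); first by ring.
transitivity (reversal_sign (2 * m) k * sine_vec R k p
  * (- ('i%C * 'i%C) * (-1) ^+ p - 'i%C)); last by ring.
by rewrite s2 i2; ring.
Qed.

(** [S] turns an eigenvector of [T] for [l] into one for [-l]; under [T^2] both have eigenvalue
    [l^2]. *)
Lemma mirror_vec_path2 n (k p : 'I_n) :
  ap T (ap T (mirror_vec k)) p
  = (- 4 * cos (sine_angle R n k) ^+ 2)%:C%C * mirror_vec k p.
Proof.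
set l : C := 2 * 'i%C * (cos (sine_angle R n k))%:C%C.
have e1 : ap T (mirror_vec k) =1
    fun q => l * sine_vec R k q + (- ('i%C * l)) * ap S (sine_vec R k) q.
  move=> q; rewrite (eq_ap _ _ (mirror_vecE k)) ap_add ap_scale ap_path_sign.
  by rewrite !ap_sign sine_vec_path -/l; ring.
rewrite (eq_ap _ _ e1) ap_add !ap_scale ap_path_sign mirror_vecE !ap_sign.
rewrite sine_vec_path -/l.
have -> : (- 4 * cos (sine_angle R n k) ^+ 2)%:C%C = l * l :> C.
  rewrite (_ : l * l = 4 * ('i%C ^+ 2) * (cos (sine_angle R n k))%:C%C ^+ 2).
    by rewrite sqr_i rmorphM rmorphXn rmorphN rmorph_nat; ring.
  by rewrite /l; ring.
by ring.
Qed.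

(** The diagonal factors multiply to the constant [1 - i^2 = 2], which leaves the orthogonality of
    the sines. *)
Lemma mirror_orthogonal n (k l : 'I_n) :
  \sum_p mirror_covec k p * mirror_vec l p = (k == l)%:R * n.+1%:R.
Proof.
have e p : mirror_covec k p * mirror_vec l p
    = 2 * (sine_covec R k p * sine_vec R l p).
  rewrite /mirror_covec /mirror_vec mulrACA; congr (_ * _).
  rewrite -subr_sqr exprMn sqr_i sqrr_sign expr1n mulr1 opprK.
  by [].
under eq_bigr do rewrite e.
by rewrite -mulr_sumr sine_orthogonal; field.
Qed.

Variables m1 m2 m3 : nat.
Hypothesis hm1 : (0 < m1)%N.
Local Notation vertex := (gvertex (2 * m1) (2 * m2) (2 * m3)).

(** The product [d * eta] of [skew_tens] for the last two factors of [eigenvec w], which the power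
    [z^(2 m1)] must match. *)
Definition twist (w : vertex) : C :=
  - 'i%C * reversal_sign (2 * m2) w.1.2 * reversal_sign (2 * m3) w.2.

Lemma twist_sqr w : twist w ^+ 2 = -1.
Proof. by rewrite /twist exprMn exprMn !reversal_sign_sqr sqrrN sqr_i; ring. Qed.

Definition twist_bit (w : vertex) : bool := twist w == 'i%C.

Lemma twistE w : twist w = (-1) ^+ twist_bit w * - 'i%C.
Proof.
rewrite /twist_bit; have : twist w ^+ 2 == 'i%C ^+ 2 by rewrite twist_sqr sqr_i.
rewrite eqf_sqr => /orP[] /eqP e; first by rewrite e eqxx expr1 mulN1r opprK.
rewrite e; case: eqP => [h|_]; last by rewrite expr0 mul1r.
by rewrite h expr1 mulN1r h.
Qed.

Definition twist_vec (w : vertex) (p : 'I_(2 * m1)) : C :=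
  twist_root R (2 * m1) (twist_bit w) w.1.1 ^+ p.

Definition twist_covec (w : vertex) (p : 'I_(2 * m1)) : C :=
  (twist_root R (2 * m1) (twist_bit w) w.1.1)^-1 ^+ p.

Definition eigenvec (w : vertex) : vertex -> C :=
  tens (twist_vec w) (mirror_vec w.1.2) (sine_vec R w.2).

Definition coeigenvec (w : vertex) : vertex -> C :=
  tens (twist_covec w) (mirror_covec w.1.2) (sine_covec R w.2).

(** The eigenvectors are not a product basis, because the first factor depends on all of [w] through
    its twist. The last two factors are compared first; once they agree, so do the twists. *)
Lemma eigenvec_orthogonal u w :
  ap coeigenvec (eigenvec w) u
  = (u == w)%:R * ((2 * m1)%:R * (2 * m2).+1%:R * ((2 * m3).+1%:R / 2)).
Proof.
rewrite /ap /coeigenvec /eigenvec.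
transitivity (\sum_v tens (fun p => twist_covec u p * twist_vec w p)
    (fun q => mirror_covec u.1.2 q * mirror_vec w.1.2 q)
    (fun r => sine_covec R u.2 r * sine_vec R w.2 r) v).
  by apply: eq_bigr => v _; rewrite /tens; ring.
rewrite sum_tens mirror_orthogonal sine_orthogonal.
case: u w => [[j k] l] [[j' k'] l'] /=; rewrite !xpair_eqE.
have [->|_] := eqVneq k k'; last by rewrite !(andbF, mul0r, mulr0).
have [->|_] := eqVneq l l'; last by rewrite !(andbF, mul0r, mulr0).
rewrite !andbT /twist_covec /twist_vec /=.
have -> : twist_bit (j', k', l') = twist_bit (j, k', l') by [].
by rewrite twist_orthogonal; ring.
Qed.

Variables x a1 a2 a3 : R.

(** The eigenvalue of [x^2] minus the squared skew part. The bit may be fixed to [false] since only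
    the squared sine enters. *)
Definition sq_eigenvalue (w : vertex) : R :=
  x ^+ 2 + 4 * a1 ^+ 2 * sin (twist_angle R (2 * m1) false w.1.1) ^+ 2
  + 4 * a2 ^+ 2 * cos (sine_angle R (2 * m2) w.1.2) ^+ 2
  + 4 * a3 ^+ 2 * cos (sine_angle R (2 * m3) w.2) ^+ 2.

(** Stated over any ring so that the real determinant can be compared with its complexification,
    where the eigenvectors live. *)
Definition kasteleyn (F : comNzRingType) (y b1 b2 b3 : F) (u v : vertex) : F :=
  y * (u == v)%:R + skew_op b1 b2 b3 u v.

Definition skewC := @skew_op m1 m2 m3 C a1%:C%C a2%:C%C a3%:C%C.

Lemma skew_sq_eigenvec w u :
  ap skewC (ap skewC (eigenvec w)) u
  = (x ^+ 2 - sq_eigenvalue w)%:C%C * eigenvec w u.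
Proof.
have n0 : (0 < 2 * m1)%N by lia.
rewrite /skewC (@skew_sq_tens _ _ _ _ _ _ _ _ _ _
   (- 'i%C * reversal_sign (2 * m2) w.1.2) (reversal_sign (2 * m3) w.2)
   (twist_root R (2 * m1) (twist_bit w) w.1.1
     - (twist_root R (2 * m1) (twist_bit w) w.1.1)^-1)
   (- 4 * cos (sine_angle R (2 * m2) w.1.2) ^+ 2)%:C%C
   (2 * 'i%C * (cos (sine_angle R (2 * m3) w.2))%:C%C)).
- congr (_ * _); rewrite /twist_root -cisN cis_subN.
  have -> : sin (twist_angle R (2 * m1) (twist_bit w) w.1.1) ^+ 2
      = sin (twist_angle R (2 * m1) false w.1.1) ^+ 2.
    rewrite /twist_angle; case: (twist_bit w) => //=.
    by rewrite expr1 expr0 mul1r mulN1r sinN sqrrN.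
  have -> (c : R) : (2 * 'i%C * c%:C%C) ^+ 2 = (- 4 * c ^+ 2)%:C%C :> C.
    by rewrite !exprMn sqr_i rmorphM rmorphXn rmorphN rmorph_nat; ring.
  rewrite -!rmorphXn -!rmorphM -!rmorphD; congr (_ %:C)%C.
  by rewrite /sq_eigenvalue; ring.
- exact: mirror_vec_rev.
- by move=> i; rewrite sine_vec_rev.
- exact: mirror_vec_path2.
- exact: sine_vec_path.
- move=> i; apply: ap_path_twist; [exact: cis_neq0|exact: twist_sqr|].
  by rewrite twist_rootX // -twistE.
Qed.

Lemma det_kasteleyn_opp (F : comNzRingType) (y b1 b2 b3 : F) :
  \det (mxf (fun u v : vertex => y * (u == v)%:R - skew_op b1 b2 b3 u v))
  = \det (mxf (kasteleyn y b1 b2 b3)).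
Proof.
rewrite -det_tr; congr (\det _); apply/matrixP => i j; rewrite !mxE.
by rewrite /kasteleyn skew_op_antisym opprK eq_sym.
Qed.

Lemma det_kasteleynC_sqr :
  \det (mxf (kasteleyn x%:C%C a1%:C%C a2%:C%C a3%:C%C)) ^+ 2
  = \prod_w (sq_eigenvalue w)%:C%C.
Proof.
rewrite expr2 -[X in _ * X]det_kasteleyn_opp.
apply: (det_mxf_eigenbasis (P := fun u w => eigenvec w u) (Q := coeigenvec)
  (e := fun=> (2 * m1)%:R * (2 * m2).+1%:R * ((2 * m3).+1%:R / 2))).
- move=> u w.
  have apE (c : C) (e : C) f v :
      ap (fun u v => c * (u == v)%:R + e * skewC u v) f v
      = c * f v + e * ap skewC f v.
    by rewrite apD !apZ ap_id.
  have eB : ap (fun u v => x%:C%C * (u == v)%:R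
        - skew_op a1%:C%C a2%:C%C a3%:C%C u v) (eigenvec w)
      =1 fun v => x%:C%C * eigenvec w v + (-1) * ap skewC (eigenvec w) v.
    move=> v; rewrite -apE; apply: eq_bigr => t _.
    by rewrite mulN1r.
  rewrite (eq_ap _ _ eB).
  transitivity (ap (fun u v => x%:C%C * (u == v)%:R + 1 * skewC u v)
    (fun v => x%:C%C * eigenvec w v + (-1) * ap skewC (eigenvec w) v) u).
    by apply: eq_bigr => t _; rewrite mul1r.
  rewrite apE ap_add !ap_scale skew_sq_eigenvec rmorphB rmorphXn /=; ring.
- by move=> u w; rewrite -eigenvec_orthogonal.
- by move=> _; rewrite !mulf_neq0 ?invr_eq0 ?pnatr_eq0 //; lia.
Qed.

Lemma det_kasteleyn_sqr :
  \det (mxf (kasteleyn x a1 a2 a3)) ^+ 2 = \prod_w sq_eigenvalue w.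
Proof.
apply: (@complexI R); rewrite rmorphXn rmorph_prod /= -det_kasteleynC_sqr.
rewrite -det_map_mx; congr (\det _ ^+ 2); apply/matrixP => i j; rewrite !mxE.
rewrite /kasteleyn /skew_op /kron /path_op /sign_op /corner_op /signrev_op.
rewrite /rev_op /id_op.
by rewrite !(rmorphD, rmorphB, rmorphM, rmorphN, rmorphXn, rmorph_nat,
   rmorphN1, rmorph1).
Qed.

End SkewSpectrum.

(** * Extraction of the square root *)

Lemma horner_char_poly_opp (F : comNzRingType) n (M : 'M[F]_n) y :
  (char_poly (- M)).[y] = \det (y%:M + M).
Proof.
rewrite /char_poly -[LHS]horner_evalE -det_map_mx; congr (\det _).
apply/matrixP => i j; rewrite !mxE /= horner_evalE !hornerE.
by rewrite hornerMn hornerX opprK.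
Qed.

Lemma poly_eq_ext (F : numDomainType) (p q : {poly F}) :
  (forall y, p.[y] = q.[y]) -> p = q.
Proof.
move=> e; apply/eqP; rewrite -subr_eq0; apply/negPn/negP => nz.
(* Distinct points, one more than the degree of [p - q]. *)
pose s := [seq i%:R : F | i <- iota 0 (size (p - q))].
have us : uniq s by rewrite map_inj_uniq ?iota_uniq // => i j /eqP;
  rewrite eqr_nat => /eqP.
have rs : all (root (p - q)) s.
  by apply/allP => y _; rewrite rootE hornerD hornerN e subrr.
by have := max_poly_roots nz rs us; rewrite size_map size_iota ltnn.
Qed.

Lemma monic_sqr_inj (F : numDomainType) (p q : {poly F}) :
  p \is monic -> q \is monic -> p ^+ 2 = q ^+ 2 -> p = q.
Proof.
move=> hp hq /eqP; rewrite eqf_sqr => /orP[/eqP //|/eqP e].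
have := monicP hp; rewrite e lead_coefN (monicP hq) => /eqP.
by rewrite -subr_eq0 -opprD oppr_eq0 (pnatr_eq0 F 2).
Qed.

Lemma prod_double_reflect (F : comNzRingType) m (h : nat -> F) :
  (forall k, (k < 2 * m)%N -> h (2 * m - k.+1)%N = h k) ->
  \prod_(k < 2 * m) h k = \prod_(k < m) h k ^+ 2.
Proof.
move=> hh; rewrite -(big_mkord xpredT h) (big_cat_nat (n := m)) //=; last by lia.
rewrite (big_addn 0 (2 * m) m) (_ : (2 * m - m = m)%N); last by lia.
rewrite !big_mkord prodrXl expr2; congr (_ * _).
rewrite (reindex_inj rev_ord_inj) /=; apply: eq_bigr => k _.
have hk := ltn_ord k; rewrite -hh; last by lia.
by congr h; lia.
Qed.

Lemma prod_double_shift (F : comNzRingType) m (h : nat -> F) :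
  (forall k, h (k + m)%N = h k) ->
  \prod_(k < 2 * m) h k = \prod_(k < m) h k ^+ 2.
Proof.
move=> hh; rewrite -(big_mkord xpredT h) (big_cat_nat (n := m)) //=; last by lia.
rewrite (big_addn 0 (2 * m) m) (_ : (2 * m - m = m)%N); last by lia.
rewrite !big_mkord prodrXl expr2; congr (_ * _).
by apply: eq_bigr.
Qed.

(** * Multiplicity of the factors and choice of the sign *)

Section Product.
Variables (R : realType) (m1 m2 m3 : nat) (a1 a2 a3 : R).
Hypothesis hm1 : (0 < m1)%N.

(** The part of a factor free of [x], kept apart so that the product can be read as a polynomial in
    [x]. *)
Definition spectral_const (i1 i2 i3 : nat) : R :=
  4 * a1 ^+ 2 * sin ((4 * i1%:R - 1) * pi / (4 * m1%:R)) ^+ 2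
  + 4 * a2 ^+ 2 * cos (i2%:R * pi / (2 * m2%:R + 1)) ^+ 2
  + 4 * a3 ^+ 2 * cos (i3%:R * pi / (2 * m3%:R + 1)) ^+ 2.

Lemma spectral_const_shift1 i1 i2 i3 :
  spectral_const (i1 + m1) i2 i3 = spectral_const i1 i2 i3.
Proof.
have m10 : m1%:R != 0 :> R by rewrite pnatr_eq0 -lt0n.
rewrite /spectral_const.
rewrite (_ : (4 * (i1 + m1)%:R - 1) * pi / (4 * m1%:R)
           = (4 * i1%:R - 1) * pi / (4 * m1%:R) + pi); last first.
  by rewrite natrD; field.
by rewrite sinDpi sqrrN.
Qed.

Lemma cos_sqr_reflect m k : (k < 2 * m)%N ->
  cos ((2 * m - k.+1).+1%:R * pi / (2 * m%:R + 1)) ^+ 2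
  = cos (k.+1%:R * pi / (2 * m%:R + 1)) ^+ 2 :> R.
Proof.
move=> hk; have n0 : 2 * m%:R + 1 != 0 :> R by rewrite -natrM natr1 pnatr_eq0.
rewrite (_ : (2 * m - k.+1).+1%:R * pi / (2 * m%:R + 1)
  = - (k.+1%:R * pi / (2 * m%:R + 1)) + pi).
  by rewrite cosDpi cosN sqrrN.
rewrite -subSn // subSS natrB; last by lia.
by rewrite natrM -natr1; field.
Qed.

(** A shift of [i1] by [m1] and the reflections of [i2] and [i3] preserve a factor, so it occurs for
    eight index triples: the square of a fourth power. *)
Lemma prod_sq_eigenvalue x :
  \prod_(w : gvertex (2 * m1) (2 * m2) (2 * m3)) sq_eigenvalue x a1 a2 a3 w
  = (\prod_(i1 < m1) \prod_(i2 < m2) \prod_(i3 < m3)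
      (x ^+ 2 + spectral_const i1.+1 i2.+1 i3.+1) ^+ 4) ^+ 2.
Proof.
have m10 : m1%:R != 0 :> R by rewrite pnatr_eq0 -lt0n.
transitivity (\prod_(i1 < 2 * m1) \prod_(i2 < 2 * m2) \prod_(i3 < 2 * m3)
    (x ^+ 2 + spectral_const i1.+1 i2.+1 i3.+1)).
  rewrite pair_big /= pair_big /=; apply: eq_bigr => -[[j k] l] _ /=.
  rewrite /sq_eigenvalue /spectral_const /twist_angle /sine_angle /=.
  rewrite expr0 mul1r !addrA;
  congr (_ + _ * sin _ ^+ 2 + _ * cos _ ^+ 2 + _ * cos _ ^+ 2).
  - by rewrite natrM -natr1; field.
  - by rewrite -[(2 * m2).+1%:R]natr1 natrM.
  - by rewrite -[(2 * m3).+1%:R]natr1 natrM.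
rewrite (prod_double_shift (h := fun i1 => \prod_(i2 < 2 * m2) \prod_(i3 < 2 * m3)
    (x ^+ 2 + spectral_const i1.+1 i2.+1 i3.+1))); last first.
  by move=> k; apply: eq_bigr => ? _; apply: eq_bigr => ? _;
    rewrite -addSn spectral_const_shift1.
rewrite prodrXl; congr (_ ^+ 2); apply: eq_bigr => i1 _.
rewrite (prod_double_reflect (h := fun i2 => \prod_(i3 < 2 * m3)
    (x ^+ 2 + spectral_const i1.+1 i2.+1 i3.+1))); last first.
  by move=> k hk; apply: eq_bigr => ? _; rewrite /spectral_const cos_sqr_reflect.
apply: eq_bigr => i2 _.
rewrite (prod_double_reflect (h := fun i3 =>
    (x ^+ 2 + spectral_const i1.+1 i2.+1 i3.+1))); last first.
  by move=> k hk; rewrite /spectral_const cos_sqr_reflect.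
by rewrite -prodrXl; apply: eq_bigr => i3 _; rewrite -exprM.
Qed.

(** At a single [x] equal squares leave the sign open. Reading the determinant as a characteristic
    polynomial, with [y] in place of [x], lets the leading coefficient decide it. *)
Lemma det_kasteleynE x :
  \det (mxf (@kasteleyn m1 m2 m3 R x a1 a2 a3))
  = \prod_(i1 < m1) \prod_(i2 < m2) \prod_(i3 < m3)
      (x ^+ 2 + spectral_const i1.+1 i2.+1 i3.+1) ^+ 4.
Proof.
pose M := mxf (@skew_op m1 m2 m3 R a1 a2 a3).
have hM y : (char_poly (- M)).[y] = \det (mxf (@kasteleyn m1 m2 m3 R y a1 a2 a3)).
  rewrite horner_char_poly_opp; congr (\det _); apply/matrixP => i j; rewrite !mxE.
  by rewrite /kasteleyn (inj_eq enum_val_inj) mulr_natr.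
pose q : {poly R} := \prod_(i1 < m1) \prod_(i2 < m2) \prod_(i3 < m3)
      ('X^2 + (spectral_const i1.+1 i2.+1 i3.+1)%:P) ^+ 4.
have hq y : q.[y] = \prod_(i1 < m1) \prod_(i2 < m2) \prod_(i3 < m3)
      (y ^+ 2 + spectral_const i1.+1 i2.+1 i3.+1) ^+ 4.
  rewrite /q horner_prod; apply: eq_bigr => i1 _; rewrite horner_prod.
  apply: eq_bigr => i2 _; rewrite horner_prod; apply: eq_bigr => i3 _.
  by rewrite horner_exp hornerD hornerXn hornerC.
rewrite -hM -hq; congr (_.[_]); apply: monic_sqr_inj.
- exact: char_poly_monic.
- do 3!(apply: monic_prod => ? _); apply: monic_exp.
  by rewrite monicE lead_coefDl ?lead_coefXn // size_polyXn;
    apply: leq_ltn_trans (size_polyC_leq1 _) _.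
- apply: poly_eq_ext => y.
  by rewrite !horner_exp hM hq det_kasteleyn_sqr // prod_sq_eigenvalue.
Qed.

End Product.

Theorem theorem4p4 (R : realType) (m1 m2 m3 : nat)
  (hm1 : (0 < m1)%N) (hm2 : (0 < m2)%N) (hm3 : (0 < m3)%N)
  (x a1 a2 a3 : R)
  (O : rel (gvertex (2 * m1) (2 * m2) (2 * m3)))
  (hO : moebius_orientation O) :
  partition_function (@moebius (2 * m1) (2 * m2) (2 * m3)) O
    (fun _ => x) (moebius_weight a1 a2 a3)
  = \prod_(1 <= i1 < m1.+1) \prod_(1 <= i2 < m2.+1) \prod_(1 <= i3 < m3.+1)
      (x ^+ 2
       + 4 * a1 ^+ 2 * sin ((4 * i1%:R - 1) * pi / (4 * m1%:R)) ^+ 2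
       + 4 * a2 ^+ 2 * cos (i2%:R * pi / (2 * m2%:R + 1)) ^+ 2
       + 4 * a3 ^+ 2 * cos (i3%:R * pi / (2 * m3%:R + 1)) ^+ 2) ^+ 4.
Proof.
rewrite (partition_function_det _ _ _
  (col := fun u : gvertex (2 * m1) (2 * m2) (2 * m3) =>
            odd (u.1.1 + u.1.2 + u.2)%N) (moebius_bipartite hm1)).
rewrite detf_mxf.
rewrite (eq_mxf (signed_adjacencyE hm1 hO x a1 a2 a3)).
rewrite -/(kasteleyn x a1 a2 a3) det_kasteleynE //.
rewrite big_add1 big_mkord; apply: eq_bigr => i1 _.
rewrite big_add1 big_mkord; apply: eq_bigr => i2 _.
rewrite big_add1 big_mkord; apply: eq_bigr => i3 _.
by rewrite /spectral_const !addrA.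
Qed.
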